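(* Let $q$ be a positive integer. The real-extreme Khovanov homology groups of the torus link $T(3,q)$ on 3 strands are isomorphic to the reduced homology groups of the independence complex of $C_{2q}$. More precisely, $$H^{i,\overline{j}}(T(3,q))=\tilde{H}_{2q-1-i}(I_{C_{2q}})=\begin{cases}\mathbb{Z} & \text{if } 2q=3k\pm1,\ i=2q-k,\\ \mathbb{Z}\oplus\mathbb{Z} & \text{if } 2q=3k,\ i=2q-k,\\ 0 & \text{otherwise.}\end{cases}$$
   Context: Torus link: for positive integers $p,q$, $T(p,q)$ is the positive torus link of type $(p,q)$, represented by the closure of the braid $(\sigma_{p-1}\cdots\sigma_2\sigma_1)^q$ on $p$ strands, with all crossings positive. $C_n$ is the cycle graph of order $n$ (the $n$-gon). The independence complex $I_G$ of a loopless graph $G$ is the simplicial complex whose simplices are the independent vertex sets of $G$ (including $\emptyset$); $\tilde H_*$ is reduced integral simplicial homology. In the formula, $k$ is the integer for which $2q$ has the form $3k$ or $3k\pm1$, and $\overline{j}=\overline{j}(T(3,q))$ is defined below. Khovanov homology (conventions). Let $D$ be an oriented link diagram with writhe $w$ (number of positive crossings minus number of negative crossings). A state $s$ assigns a label $A$ or $B$ to each crossing; $\sigma(s)$ is the number of $A$-labels minus the number of $B$-labels. Smooth each crossing according to its label ($A$ and $B$ are the usual Kauffman smoothings; at a positive crossing the $A$-smoothing is the oriented one). An enhanced state also assigns a sign $\epsilon=\pm1$ to each of the resulting circles; $\tau(s)$ is the sum of the signs. Put $i(s)=(w-\sigma(s))/2$ and $j(s)=w+i(s)+\tau(s)$.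 $C^{i,j}(D)$ is the free abelian group on the enhanced states with $i(s)=i$, $j(s)=j$. An enhanced state $t$ is adjacent to $s$ if they are identical except near one crossing, where the label changes from $A$ in $s$ to $B$ in $t$, and signs change by the rules: merging two circles, $(++\to+)$, $(+-\to-)$, $(-+\to-)$; splitting one circle, $(+\to+-)$, $(+\to-+)$, $(-\to--)$. After ordering the crossings, the differential is $d_i(s)=\sum_t(s:t)\,t$ over adjacent $t$, with $(s:t)=(-1)^{r}$, $r$ the number of $B$-labelled crossings coming after the changed crossing. The homology groups $H^{i,j}(D)=\ker d_i/\mathrm{im}\, d_{i-1}$ are invariants of the oriented link $L$ represented by $D$, denoted $H^{i,j}(L)$ (Khovanov homology). $\overline{j}(L)$ is the largest $j$ such that $H^{i,j}(L)$ is non-trivial for at least one $i$; the groups $H^{i,\overline{j}}(L)$ are the real-extreme Khovanov homology groups of $L$.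
   Formalization: The formal theorem assumes q ≥ 2: for q = 1 the link T(3,1) is the unknot, whose only nonzero groups are H^{0,1} = H^{0,-1} = Z, so the real-extreme group H^{1,1} is 0, while the stated formula (k = 1, i = 1) gives Z. *)

(* Defs.v *)
From HB Require Import structures.
From mathcomp Require Import all_boot all_order all_algebra.
From mathcomp Require Import ring_quotient boolp.

Set Implicit Arguments.
Unset Strict Implicit.
Unset Printing Implicit Defensive.

Import Order.TTheory GRing.Theory Num.Theory.
Local Open Scope ring_scope.

(** * Homology of a pair of composable maps *)

Section Homology.
Variables (U V W : zmodType) (f : {additive U -> V}) (g : {additive V -> W}).

Definition ker_pred : {pred V} := fun v => g v == 0.

Fact ker_pred_zmod_closed : zmod_closed ker_pred.
Proof.
split=> [|x y]; rewrite !unfold_in ?raddf0 // => /eqP gx /eqP gy.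
by rewrite raddfB gx gy subrr.
Qed.

HB.instance Definition _ := GRing.isZmodClosed.Build V ker_pred
  ker_pred_zmod_closed.

Definition ker_type := {v : V | v \in ker_pred}.

HB.instance Definition _ := Choice.on ker_type.
HB.instance Definition _ := SubChoice.on ker_type.
HB.instance Definition _ := [SubChoice_isSubZmodule of ker_type by <:].

Definition im_pred : {pred ker_type} := fun z => `[< exists u, f u = val z >].

Fact im_pred_zmod_closed : zmod_closed im_pred.
Proof.
split=> [|x y]; rewrite !unfold_in.
  by apply/asboolP; exists 0; rewrite !raddf0.
move=> /asboolP[u fu] /asboolP[v fv].
by apply/asboolP; exists (u - v); rewrite !raddfB fu fv.
Qed.

HB.instance Definition _ := GRing.isZmodClosed.Build ker_type im_pred
  im_pred_zmod_closed.

(* This is ker g / (im f `&` ker g), i.e. ker g / im f whenever g \o f = 0. *)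
Definition homology : zmodType := Quotient.quot im_pred.

End Homology.

Definition zmod_iso (A B : zmodType) : Prop :=
  exists f : {additive A -> B}, bijective f.

Definition trivial_zmod (A : zmodType) : Prop := forall x : A, x = 0.

(** * Free chain groups *)

Section Chains.
Variables (X : finType) (inc : X -> X -> int).

Definition chain (P : pred X) : Type := {ffun {x : X | P x} -> int}.
HB.instance Definition _ P := GRing.Zmodule.on (chain P).

(* The map sending a generator x in P to the sum of the inc x y * y over the
   generators y in Q. *)
Definition boundary (P Q : pred X) (c : chain P) : chain Q :=
  [ffun y : {y : X | Q y} => \sum_(x : {x : X | P x}) c x * inc (val x) (val y)].

Fact boundary_zmod_morphism P Q : zmod_morphism (@boundary P Q).
Proof.
move=> c d; apply/ffunP=> y; rewrite !ffunE -sumrB.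
by apply: eq_bigr => x _; rewrite !ffunE mulrBl.
Qed.

HB.instance Definition _ P Q := GRing.isZmodMorphism.Build
  (chain P) (chain Q) (@boundary P Q) (@boundary_zmod_morphism P Q).

Definition chain_homology (P Q R : pred X) : zmodType :=
  homology (@boundary P Q) (@boundary Q R).

End Chains.

(** * Graphs, independence complexes, reduced simplicial homology *)

(* The n-gon; for n = 2 its two vertices are adjacent. *)
Definition cycle_graph (n : nat) : rel 'I_n :=
  [rel u v | (v == ordS u) || (u == ordS v)].

Definition independence_complex (n : nat) (G : rel 'I_n) : {set {set 'I_n}} :=
  [set S : {set 'I_n} | [forall u in S, forall v in S, ~~ G u v]].

Section SimplicialHomology.
Variables (n : nat) (K : {set {set 'I_n}}).

Definition simplex_of_dim (d : int) : pred {set 'I_n} :=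
  [pred S | (S \in K) && (#|S|%:Z - 1 == d)].

(* The coefficient of T in the boundary of S, simplices being oriented by the
   natural order of the vertices. *)
Definition face_sign (S T : {set 'I_n}) : int :=
  \sum_(v in S | T == S :\ v) (-1) ^+ #|[set u in S | (u < v)%N]|.

(* The augmented complex: the empty simplex has dimension -1. *)
Definition reduced_homology (d : int) : zmodType :=
  chain_homology face_sign
    (simplex_of_dim (d + 1)) (simplex_of_dim d) (simplex_of_dim (d - 1)).

End SimplicialHomology.

(** * Oriented link diagrams *)

(* A crossing lists its four ends counterclockwise, [end0] being the incoming
   end of the lower strand; the lower strand thus runs from end0 to end2, and
   the crossing is positive iff the upper strand runs from end3 to end1. *)
Record crossing (arc : Type) := Crossing {
  end0 : arc; end1 : arc; end2 : arc; end3 : arc; positive : bool }.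

(* Arcs related by [glued] are consecutive pieces of the same strand. *)
Record diagram := Diagram {
  arc : finType;
  ncross : nat;
  cross : 'I_ncross -> crossing arc;
  glued : rel arc }.

Section Khovanov.
Variable D : diagram.
Local Notation arc := (arc D).
Local Notation n := (ncross D).

Definition writhe : int :=
  \sum_(c < n) (if positive (cross c) then 1 else -1).

Inductive label := Alab | Blab.
Definition label_is_B (l : label) : bool := if l is Blab then true else false.
Definition label_of_bool (b : bool) : label := if b then Blab else Alab.
Fact label_of_boolK : cancel label_is_B label_of_bool. Proof. by case. Qed.
HB.instance Definition _ := Finite.copy label (can_type label_of_boolK).

Definition state : Type := {ffun 'I_n -> label}.
HB.instance Definition _ := Finite.on state.

(* The A-smoothing merges the two regions swept by the upper strand when it is
   rotated counterclockwise: it joins end0 to end1 and end2 to end3. *)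
Definition smoothing (c : crossing arc) (l : label) : rel arc :=
  [rel x y | match l with
    | Alab => ((x, y) == (end0 c, end1 c)) || ((x, y) == (end2 c, end3 c))
    | Blab => ((x, y) == (end0 c, end3 c)) || ((x, y) == (end1 c, end2 c))
    end].

Definition joined (s : state) : rel arc :=
  [rel x y | glued x y || [exists c : 'I_n, smoothing (cross c) (s c) x y]].

(* The circles of the smoothed diagram are the classes of this relation. *)
Definition same_circle (s : state) : rel arc :=
  connect [rel x y | joined s x y || joined s y x].

Definition circle_roots (s : state) : pred arc :=
  roots [rel x y | joined s x y || joined s y x].

(* A sign (true for +) on every circle is a function of the arcs which is
   constant on each circle. *)
Definition is_enhanced (se : state * {ffun arc -> bool}) : bool :=
  [forall x, forall y, same_circle se.1 x y ==> (se.2 x == se.2 y)].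

Definition enhanced_state : Type :=
  {se : state * {ffun arc -> bool} | is_enhanced se}.
HB.instance Definition _ := Finite.on enhanced_state.

Definition labels (s : enhanced_state) : state := (val s).1.
Definition sign (s : enhanced_state) (x : arc) : bool := (val s).2 x.

Definition sigma (s : enhanced_state) : int :=
  \sum_(c < n) (if labels s c is Alab then 1 else -1).

Definition tau (s : enhanced_state) : int :=
  \sum_(x | circle_roots (labels s) x) (if sign s x then 1 else -1).

(* The division is exact: the writhe and sigma have the parity of n. *)
Definition i_degree (s : enhanced_state) : int := ((writhe - sigma s) %/ 2)%Z.

Definition j_degree (s : enhanced_state) : int :=
  writhe + i_degree s + tau s.

Definition merge_rule (x y z : bool) : bool :=
  match x, y, z with
  | true, true, true | true, false, false | false, true, false => true
  | _, _, _ => false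
  end.

Definition split_rule (x y z : bool) : bool :=
  match x, y, z with
  | true, true, false | true, false, true | false, false, false => true
  | _, _, _ => false
  end.

(* Either smoothing of a crossing consists of a segment through end0 and a
   segment through end2, so the circles of a state that pass near c are those
   of end0 and end2, which may coincide. *)
Definition adjacent_at (c : 'I_n) (s t : enhanced_state) : bool :=
  let a := end0 (cross c) in
  let b := end2 (cross c) in
  [&& labels s c == Alab, labels t c == Blab,
      [forall c', (c' != c) ==> (labels t c' == labels s c')],
      [forall x, ~~ same_circle (labels s) a x ==>
                 ~~ same_circle (labels s) b x ==> (sign t x == sign s x)]
    & match same_circle (labels s) a b, same_circle (labels t) a b with
      | false, true => merge_rule (sign s a) (sign s b) (sign t a)
      | true, false => split_rule (sign s a) (sign t a) (sign t b)
      | _, _ => false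
      end].

(* (s:t) if t is adjacent to s, and 0 otherwise. *)
Definition incidence (s t : enhanced_state) : int :=
  \sum_(c < n | adjacent_at c s t)
     (-1) ^+ #|[set c' : 'I_n | (c < c')%N && (labels s c' == Blab)]|.

Definition in_bidegree (i j : int) : pred enhanced_state :=
  [pred s | (i_degree s == i) && (j_degree s == j)].

Definition khovanov (i j : int) : zmodType :=
  chain_homology incidence
    (in_bidegree (i - 1) j) (in_bidegree i j) (in_bidegree (i + 1) j).

(* jb is the largest j such that H^{i,j} is non-trivial for some i. *)
Definition is_real_jmax (jb : int) : Prop :=
  (exists i, ~ trivial_zmod (khovanov i jb)) /\
  (forall i j, ~ trivial_zmod (khovanov i j) -> j <= jb).

End Khovanov.

(** * Closures of positive braids and torus links *)

Section BraidClosure.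
(* A braid word on p.+1 strands; the letter k : 'I_p stands for the generator
   exchanging the strands number k and k.+1, counted from 0. *)
Variables (p : nat) (w : seq 'I_p).
Local Notation N := (size w).

Definition low (m : nat) (k : 'I_m) : 'I_m.+1 := widen_ord (leqnSn m) k.
Definition high (m : nat) (k : 'I_m) : 'I_m.+1 := lift ord0 k.

Definition letter (t : 'I_N) : 'I_p := tnth (in_tuple w) t.

(* The arc (t, s) is the piece of the strand in position s at level t; strands
   run upwards, the letter number t lying between the levels t and t.+1. At a
   positive crossing the upper strand goes from bottom left to top right. *)
Definition braid_arc : finType := ('I_N.+1 * 'I_p.+1)%type.

Definition braid_crossing (t : 'I_N) : crossing braid_arc :=
  let k := letter t in
  Crossing (low t, high k) (high t, high k) (high t, low k) (low t, low k) true.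

Definition braid_glued : rel braid_arc :=
  [rel x y | (x.2 == y.2) &&
    ((x.1 == ord_max) && (y.1 == ord0)
     || [exists t : 'I_N, [&& x.1 == low t, y.1 == high t,
           x.2 != low (letter t) & x.2 != high (letter t)]])].

Definition braid_closure : diagram := Diagram braid_crossing braid_glued.

End BraidClosure.

(* The closure of (sigma_{p-1} ... sigma_2 sigma_1)^q on p >= 1 strands. *)
Definition torus_link (p q : nat) : diagram :=
  braid_closure (flatten (nseq q (rev (enum 'I_p.-1)))).

(* Main.v *)
From HB Require Import structures.
Require Import Defs.
From mathcomp Require Import all_boot all_order all_algebra.
From mathcomp Require Import generic_quotient ring_quotient boolp.
From mathcomp Require Import zify ring.

Set Implicit Arguments.
Unset Strict Implicit.
Unset Printing Implicit Defensive.

Import Order.TTheory GRing.Theory Num.Theory.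
Local Open Scope ring_scope.
Local Open Scope quotient_scope.

(** The diagram has [2q] crossings, met in cyclic order and alternating between
    the two pairs of neighbouring strands.  Describe a state by the set [S] of
    its crossings labelled A.  The state with [S] empty consists of a single
    circle, and adding a crossing to [S] creates at most one circle
    ([circle_countU1]); hence there are at most [#|S| + 1] circles.  Equality
    fails as soon as [S] contains two cyclically consecutive crossings [c] and
    [ordS c], because the state [{c, ordS c}] has one circle instead of three
    ([circle_count_pair]).  It holds when [S] contains no such pair: then every
    crossing of [S] contributes a private circle ([circle_index]).  So
    [circle_count S = #|S| + 1] exactly for the independent sets [S] of the
    [2q]-gon.

    Since [i = 2q - #|S|] and [j = 2q + i + tau], every enhanced state has
    [j <= 4q + 1], with equality iff [S] is independent and all signs are plus
    ([j_degree_top]).  Between two such states the differential removes one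
    element of [S], which is the simplicial boundary up to signs, and the signs
    are absorbed in a change of basis ([inversion_sign]).  So the complex in
    degree [j = 4q + 1] is the augmented chain complex of the independence
    complex, with [i] corresponding to dimension [2q - 1 - i]
    ([khovanov_extreme]).

    There remains the homology of the independence complex of an [n]-gon
    ([reduced_homology_cycle]).  It is computed inside the exterior algebra on
    the vertices, where multiplication by a vertex [v] satisfies
    [bd (v x) = x - v (bd x)].  For a path this gives, three vertices at a time,
    a single generating cycle [(e_1 - e_0) (e_4 - e_3) ...], or none when the
    number of vertices is 1 modulo 3 ([path_cycle_span], [path_cycle_free]).
    Splitting the independent sets of the [n]-gon according to whether they
    contain the last vertex leaves the paths with [n - 1] and [n - 3] vertices,
    and their generators produce those of the [n]-gon
    ([cycle_complex_generators]).  The top degree [4q + 1] therefore carries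
    homology, and it is the largest degree that does. *)

(** * Homology groups up to isomorphism *)

Lemma zmod_iso_sym (A B : zmodType) : zmod_iso A B -> zmod_iso B A.
Proof.
case=> f [g gK fK].
have gB : zmod_morphism g.
  by move=> x y; apply: (can_inj gK); rewrite raddfB !fK.
pose G := GRing.isZmodMorphism.Build B A g gB.
pose ga : {additive B -> A} := HB.pack g G.
by exists ga; exists f.
Qed.

Lemma zmod_iso_trans (A B C : zmodType) :
  zmod_iso A B -> zmod_iso B C -> zmod_iso A C.
Proof.
case=> f bf [g bg]; exists (g \o f : {additive A -> C}).
exact: bij_comp.
Qed.

Lemma zmod_iso_trivial (A B : zmodType) :
  zmod_iso A B -> trivial_zmod B -> trivial_zmod A.
Proof.
case=> f [g gK _] B0 x.
by rewrite -[x]gK (B0 (f x)) -(B0 (f 0)) gK.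
Qed.

Lemma inj_surj_zmod_iso (A B : zmodType) (f : {additive A -> B}) :
  injective f -> (forall b, exists a, f a = b) -> zmod_iso A B.
Proof.
move=> f_inj f_surj.
have /choice[g gP] := f_surj.
by exists f; exists g => // a; apply: f_inj.
Qed.

Section HomologyElements.
Variables (U V W : zmodType) (f : {additive U -> V}) (g : {additive V -> W}).

Lemma ker_predP v : reflect (g v = 0) (v \in ker_pred g).
Proof. exact: eqP. Qed.

Lemma im_predP (z : ker_type g) :
  reflect (exists u, f u = val z) (z \in im_pred f (g := g)).
Proof. exact: asboolP. Qed.

Lemma ker_valB (a b : ker_type g) : val (a - b) = val a - val b.
Proof. exact: raddfB. Qed.

Definition hclass (z : ker_type g) : homology f g := \pi z.

Lemma hclassB : {morph hclass : a b / a - b}.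
Proof. by move=> a b; rewrite /hclass raddfB. Qed.

Lemma hclass_repr x : hclass (repr x) = x.
Proof. exact: reprK. Qed.

Lemma hclass_eq0 (z : ker_type g) :
  (hclass z == 0) = (z \in im_pred f (g := g)).
Proof. by rewrite -[z in RHS]subr0 Quotient.idealrBE raddf0. Qed.

Lemma homology_trivial :
  (forall v, g v = 0 -> exists u, f u = v) -> trivial_zmod (homology f g).
Proof.
move=> exact_fg x; rewrite -[x]hclass_repr; apply/eqP; rewrite hclass_eq0.
by apply/im_predP/exact_fg/ker_predP/(valP (repr x)).
Qed.

Lemma kernel_zmod_iso (B : zmodType) (r : {additive ker_type g -> B}) :
  (forall z, r z = 0 <-> exists u, f u = val z) ->
  (forall b, exists z, r z = b) -> zmod_iso (homology f g) B.
Proof.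
move=> ker_r r_surj.
have r_repr (z : ker_type g) : r (repr (hclass z)) = r z.
  apply/eqP; rewrite -subr_eq0 -raddfB; apply/eqP/ker_r/im_predP.
  by rewrite Quotient.idealrBE reprK.
have hB : zmod_morphism (fun x : homology f g => r (repr x)).
  move=> x y; rewrite -raddfB -[RHS]r_repr; congr (r (repr _)).
  by rewrite hclassB !hclass_repr.
pose H := GRing.isZmodMorphism.Build (homology f g) B _ hB.
pose h : {additive homology f g -> B} :=
  HB.pack (fun x : homology f g => r (repr x)) H.
apply: (@inj_surj_zmod_iso _ _ h) => [x y hxy|b].
  apply/eqP; rewrite -subr_eq0 -[x - y]hclass_repr hclass_eq0.
  apply/im_predP/ker_r; rewrite -[LHS]/(h (x - y)) raddfB.
  by apply/eqP; rewrite subr_eq0; apply/eqP.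
by have [z <-] := r_surj b; exists (hclass z); apply: r_repr.
Qed.

(** The usual way to read off a homology group: [s] picks representing cycles. *)
Lemma homology_free (B : zmodType) (s : {additive B -> V}) :
  (forall b, g (s b) = 0) ->
  (forall v, g v = 0 -> exists b u, v = s b + f u) ->
  (forall b u, s b = f u -> b = 0) -> zmod_iso (homology f g) B.
Proof.
move=> gs s_surj s_inj; apply: zmod_iso_sym.
pose z b : ker_type g := Sub (s b) (introT (ker_predP (s b)) (gs b)).
have valz b : val (z b) = s b by [].
have hB : zmod_morphism (fun b => hclass (z b)).
  move=> a b; rewrite -hclassB; congr (hclass _); apply: val_inj.
  by rewrite raddfB !SubK raddfB.
pose H := GRing.isZmodMorphism.Build B (homology f g) _ hB.
pose h : {additive B -> homology f g} :=
  HB.pack (fun b => hclass (z b)) H.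
apply: (@inj_surj_zmod_iso _ _ h) => [a b /eqP|x].
  rewrite -subr_eq0 -hclassB hclass_eq0 => /im_predP[u].
  rewrite ker_valB !valz -raddfB => /esym/s_inj.
  by move/eqP; rewrite subr_eq0 => /eqP.
have /ker_predP/s_surj[b [u def_x]] := valP (repr x).
exists b; rewrite -[x]hclass_repr; apply/eqP; rewrite -subr_eq0 -hclassB hclass_eq0.
apply/im_predP; exists (- u); rewrite ker_valB valz def_x raddfN.
by rewrite opprD addrA subrr add0r.
Qed.

End HomologyElements.

Lemma homology_iso (U V W U' V' W' : zmodType)
    (f : {additive U -> V}) (g : {additive V -> W})
    (f' : {additive U' -> V'}) (g' : {additive V' -> W'})
    (s : {additive V -> V'}) :
  (forall v, g v = 0 <-> g' (s v) = 0) ->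
  (forall v, (exists u, f u = v) <-> (exists u, f' u = s v)) ->
  (forall v', exists v, s v = v') ->
  zmod_iso (homology f g) (homology f' g').
Proof.
move=> ker_s im_s s_surj.
have sk (z : ker_type g) : s (val z) \in ker_pred g'.
  exact/ker_predP/ker_s/ker_predP/(valP z).
pose t (z : ker_type g) : ker_type g' := Sub (s (val z)) (sk z).
have hB : zmod_morphism (fun z => hclass f' (t z)).
  move=> a b; rewrite -hclassB; congr (hclass _ _); apply: val_inj.
  by rewrite raddfB !SubK !raddfB.
pose H := GRing.isZmodMorphism.Build (ker_type g) (homology f' g') _ hB.
pose h : {additive ker_type g -> homology f' g'} :=
  HB.pack (fun z => hclass f' (t z)) H.
apply: (@kernel_zmod_iso _ _ _ _ _ _ h) => [z|x].
  rewrite im_s; split=> [/eqP|im_z].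
    by rewrite hclass_eq0 => /im_predP; rewrite SubK.
  by apply/eqP; rewrite hclass_eq0; apply/im_predP; rewrite SubK.
have [v sv] := s_surj (val (repr x)).
have gv : v \in ker_pred g.
  by apply/ker_predP/ker_s; rewrite sv; apply/ker_predP/(valP (repr x)).
exists (Sub v gv); rewrite -[x]hclass_repr; congr (hclass _ _); apply: val_inj.
by rewrite !SubK.
Qed.

(** * Chain groups on subsets of a fixed basis *)

Section ChainCoefficients.
Variables (X : finType) (inc : X -> X -> int).

(** Working with functions on the whole basis, extended by zero, avoids
    transporting membership proofs from one chain group to another. *)
Definition coef (P : pred X) (c : chain P) (x : X) : int :=
  if insub x is Some u then c u else 0.

Definition of_coef (P : pred X) (F : X -> int) : chain P :=
  [ffun u => F (val u)].

Lemma coef_val P (c : chain P) u : coef c (val u) = c u.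
Proof. by rewrite /coef valK. Qed.

Lemma coef_out P (c : chain P) x : ~~ P x -> coef c x = 0.
Proof. by move=> nPx; rewrite /coef insubN. Qed.

Lemma coef_of_coef P F x : coef (of_coef P F) x = if P x then F x else 0.
Proof.
case: ifP => Px; last by rewrite coef_out ?Px.
by rewrite -[x]/(val (Sub x Px : {x | P x})) coef_val ffunE.
Qed.

Lemma eq_coef P (c d : chain P) : coef c =1 coef d -> c = d.
Proof. by move=> cd; apply/ffunP => u; rewrite -!coef_val. Qed.

Lemma coef_sub P (c d : chain P) x : coef (c - d) x = coef c x - coef d x.
Proof. by rewrite /coef; case: insub => [u|]; rewrite ?subrr ?ffunE. Qed.

Lemma coef_boundary P Q (c : chain P) y :
  coef (boundary inc Q c) y =
    if Q y then \sum_x coef c x * inc x y else 0.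
Proof.
case: ifP => Qy; last by rewrite coef_out ?Qy.
rewrite -[y]/(val (Sub y Qy : {y | Q y})) coef_val ffunE SubK.
rewrite (bigID P) /= [X in _ + X]big1 ?addr0 => [|x nPx].
  rewrite (big_sub P (fun x => coef c x * inc x y)).
  by apply: eq_bigr => u _; rewrite coef_val.
by rewrite coef_out ?mul0r.
Qed.

End ChainCoefficients.

Section Relabelling.
Variables (X Y : finType) (incX : X -> X -> int) (incY : Y -> Y -> int).
Variables (f : X -> Y) (g : Y -> X) (eps : Y -> int).

(** Total functions [f] and [g] stand for a bijection of the generators, so that
    one pair serves all the degrees of a complex. *)
Definition matched (P : pred X) (P' : pred Y) :=
  (forall x, P x -> P' (f x) /\ g (f x) = x) /\
  (forall y, P' y -> P (g y) /\ f (g y) = y).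

Definition relabel P P' (c : chain P) : chain P' :=
  of_coef P' (fun y => eps y * coef c (g y)).

Fact relabel_zmod_morphism P P' : zmod_morphism (@relabel P P').
Proof. by move=> c d; apply/ffunP => u; rewrite !ffunE coef_sub mulrBr. Qed.

HB.instance Definition _ P P' := GRing.isZmodMorphism.Build
  (chain P) (chain P') (@relabel P P') (@relabel_zmod_morphism P P').

Hypothesis eps2 : forall y, eps y * eps y = 1.

Lemma relabel_inj P P' : matched P P' -> injective (@relabel P P').
Proof.
move=> [fP _] c d cd; apply/ffunP => u; rewrite -!coef_val.
have [P'u gfu] := fP _ (valP u).
have := congr1 (fun e => eps (f (val u)) * coef e (f (val u))) cd.
by rewrite !coef_of_coef P'u gfu !mulrA !eps2 !mul1r.
Qed.

Lemma relabel_surj P P' (c' : chain P') :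
  matched P P' -> exists c : chain P, relabel P' c = c'.
Proof.
move=> [_ gP'].
exists (of_coef P (fun x => eps (f x) * coef c' (f x))).
apply: eq_coef => y; rewrite coef_of_coef.
case: ifP => P'y; last by rewrite coef_out ?P'y.
have [Pgy fgy] := gP' _ P'y.
by rewrite coef_of_coef Pgy fgy mulrA eps2 mul1r.
Qed.

Definition compatible (P Q : pred X) := forall x z, P x -> Q z ->
  incX x z = eps (f x) * eps (f z) * incY (f x) (f z).

Lemma relabel_boundary P P' Q Q' (c : chain P) :
  matched P P' -> matched Q Q' -> compatible P Q ->
  boundary incY Q' (relabel P' c) = relabel Q' (boundary incX Q c).
Proof.
move=> [fP gP'] [_ gQ'] inc_fg; apply: eq_coef => z.
rewrite coef_boundary coef_of_coef; case: ifP => // Q'z.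
have [Qgz fgz] := gQ' _ Q'z.
rewrite coef_boundary Qgz big_distrr /=.
rewrite (bigID P') /= [X in _ + X]big1 ?addr0 => [|y nP'y]; last first.
  by rewrite coef_out ?mul0r.
rewrite [RHS](bigID P) /= [X in _ = _ + X]big1 ?addr0 => [|x nPx]; last first.
  by rewrite coef_out ?mul0r ?mulr0.
rewrite [RHS](reindex_onto g f) => [|x /fP[] //].
apply: eq_big => [y|y P'y].
  apply/idP/andP => [/gP'[Pgy ->] // | [/fP[P'fgy _] /eqP <-] //].
have [Pgy fgy] := gP' _ P'y.
rewrite coef_of_coef P'y (inc_fg _ _ Pgy Qgz) fgy fgz.
rewrite [RHS]mulrCA [eps y * eps z]mulrC -[eps z * _ * _]mulrA.
by rewrite [eps z * (eps z * _)]mulrA eps2 mul1r mulrCA mulrA.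
Qed.

(** A bijection of bases that matches the incidence numbers up to the sign
    change [eps] of the basis is an isomorphism of complexes. *)
Lemma chain_homology_relabel P Q R P' Q' R' :
  matched P P' -> matched Q Q' -> matched R R' ->
  compatible P Q -> compatible Q R ->
  zmod_iso (chain_homology incX P Q R) (chain_homology incY P' Q' R').
Proof.
move=> mP mQ mR cPQ cQR.
apply: (@homology_iso _ _ _ _ _ _ _ _ _ _ (@relabel Q Q')) => [c|c|c'].
- rewrite /= (relabel_boundary c mQ mR cQR); split=> [->|].
    exact: raddf0.
  by rewrite -(raddf0 (@relabel R R')) => /(relabel_inj mR).
- split=> -[u def_c].
    by exists (relabel P' u); rewrite /= (relabel_boundary u mP mQ cPQ) -def_c.
  have [v def_u] := relabel_surj u mP; exists v; apply: (relabel_inj mQ).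
  by rewrite -def_c -def_u /= (relabel_boundary v mP mQ cPQ).
exact: relabel_surj.
Qed.

End Relabelling.

(** * The exterior algebra of chains of the full simplex *)

Section Exterior.
Variable n : nat.
Local Notation M := {ffun {set 'I_n} -> int}.
Implicit Types (S T : {set 'I_n}) (u v : 'I_n) (x y z w : M) (p q : pred {set 'I_n}).

(** The sign moving [v] to its place among the elements of [S]. *)
Definition vsign v S : int := (-1) ^+ #|[set u in S | (u < v)%N]|.

Definition wedge v x : M :=
  [ffun S : {set 'I_n} => if v \in S then vsign v S * x (S :\ v) else 0].

Definition bd x : M :=
  [ffun T : {set 'I_n} => \sum_(v | v \notin T) vsign v T * x (v |: T)].

Fact wedge_zmod_morphism v : zmod_morphism (wedge v).
Proof.
move=> x y; apply/ffunP => S; rewrite !ffunE.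
by case: ifP => _; rewrite ?subrr ?mulrBr.
Qed.

HB.instance Definition _ v := GRing.isZmodMorphism.Build M M
  (wedge v) (wedge_zmod_morphism v).

Fact bd_zmod_morphism : zmod_morphism bd.
Proof.
move=> x y; apply/ffunP => S; rewrite !ffunE -sumrB.
by apply: eq_bigr => v _; rewrite !ffunE mulrBr.
Qed.

HB.instance Definition _ := GRing.isZmodMorphism.Build M M
  bd bd_zmod_morphism.

Lemma wedge0 v : wedge v 0 = 0. Proof. exact: raddf0. Qed.

Lemma wedgeN v x : wedge v (- x) = - wedge v x. Proof. exact: raddfN. Qed.

Lemma wedgeD v x y : wedge v (x + y) = wedge v x + wedge v y.
Proof. exact: raddfD. Qed.

Lemma wedgeB v x y : wedge v (x - y) = wedge v x - wedge v y.
Proof. exact: raddfB. Qed.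

Lemma vsign2 v S : vsign v S * vsign v S = 1.
Proof. by rewrite -expr2 sqrr_sign. Qed.

Lemma vsign_add u v S : u \notin S ->
  vsign v (u |: S) = (-1) ^+ (u < v)%N * vsign v S.
Proof.
move=> uS; rewrite /vsign -exprD; congr (_ ^+ _).
case: (ltnP u v) => uv.
  have -> : [set i in u |: S | (i < v)%N] = u |: [set i in S | (i < v)%N].
    by apply/setP => i; rewrite !inE; case: eqVneq => // ->; rewrite uv.
  by rewrite cardsU1 !inE negb_and uS.
congr #|pred_of_set _|; apply/setP => i; rewrite !inE.
by case: eqVneq => [->|//]; rewrite [(u < v)%N]ltnNge uv /= !andbF.
Qed.

Lemma vsign_swap u v S : u != v -> u \notin S -> v \notin S ->
  vsign u (v |: S) * vsign v (u |: S) = - (vsign v S * vsign u S).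
Proof.
move=> uv uS vS; rewrite !vsign_add //.
have : (u : nat) != v by [].
by case: ltngtP => //= _ _;
  rewrite expr0 expr1 !(mul1r, mulN1r, mulNr, mulrN) mulrC.
Qed.

(** The boundary is an antiderivation taking the value 1 on every vertex; this
    is the only relation needed to build cones. *)
Lemma bd_wedge v x : bd (wedge v x) = x - wedge v (bd x).
Proof.
apply/ffunP => T; rewrite !ffunE.
have [vT|nvT] := boolP (v \in T); last first.
  rewrite subr0 (bigD1 v) //= big1 ?addr0 => [|u /andP[uT uv]].
    by rewrite ffunE setU11 vsign_add // ltnn mul1r setU1K // mulrA vsign2 mul1r.
  by rewrite ffunE !inE (negPf nvT) orbF eq_sym (negPf uv) mulr0.
have [S nvS ->] : exists2 S : {set 'I_n}, v \notin S & T = v |: S.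
  by exists (T :\ v); rewrite ?setD11 ?setD1K.
rewrite setU1K // [X in _ - _ * X](bigD1 v) //= vsign_add // ltnn mul1r mulrDr.
rewrite mulrA vsign2 mul1r opprD addrA subrr add0r mulr_sumr -sumrN.
apply: eq_big => [u|u]; rewrite !inE negb_or andbC // => /andP[uS uv].
rewrite ffunE !inE eqxx orbT mulrA setUCA setU1K; last first.
  by rewrite !inE negb_or eq_sym uv.
rewrite [vsign v (v |: _)]vsign_add ?ltnn ?mul1r ?vsign_swap ?mulNr ?mulrA //.
by rewrite !inE negb_or eq_sym uv.
Qed.

Definition supported p x := forall S, x S != 0 -> p S.

Lemma supported0 p : supported p 0.
Proof. by move=> S; rewrite ffunE eqxx. Qed.

Lemma supportedD p x y : supported p x -> supported p y -> supported p (x + y).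
Proof.
move=> px py S; rewrite ffunE; have [->|/px //] := eqVneq (x S) 0.
by rewrite add0r => /py.
Qed.

Lemma supportedN p x : supported p x -> supported p (- x).
Proof. by move=> px S; rewrite ffunE oppr_eq0 => /px. Qed.

Lemma supportedB p x y : supported p x -> supported p y -> supported p (x - y).
Proof. by move=> px py; apply: supportedD => //; apply: supportedN. Qed.

Lemma supportedMz p x (l : int) : supported p x -> supported p (x *~ l).
Proof.
move=> px; case: l => l; rewrite ?NegzE ?mulrNz -pmulrn.
  by elim: l => [|l IHl]; rewrite ?mulrSr; [apply: supported0|apply: supportedD].
by apply: supportedN; elim: l => [//|l IHl]; rewrite mulrSr; apply: supportedD.
Qed.

Lemma ffunMz x (l : int) S : (x *~ l) S = x S *~ l.
Proof.
pose ev (c : M) := c S.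
have evB : zmod_morphism ev by move=> c d; rewrite /ev !ffunE.
pose E := GRing.isZmodMorphism.Build M int ev evB.
pose eva : {additive M -> int} := HB.pack ev E.
by rewrite -[LHS]/(eva _) raddfMz.
Qed.

Lemma supported_out p x S : supported p x -> ~~ p S -> x S = 0.
Proof. by move=> px; apply: contraNeq => /px. Qed.

Lemma sub_supported p q x : (forall S, p S -> q S) ->
  supported p x -> supported q x.
Proof. by move=> pq px S /px/pq. Qed.

Lemma supported_wedge v p q x : (forall S, v \notin S -> p S -> q (v |: S)) ->
  supported p x -> supported q (wedge v x).
Proof.
move=> pq px S; rewrite ffunE; case: ifP => [vS|_]; last by rewrite eqxx.
rewrite mulf_eq0 negb_or => /andP[_ /px/pq].
by rewrite setD1K // => -> //; rewrite setD11.
Qed.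

Lemma supported_bd p q x : (forall v S, v \notin S -> p (v |: S) -> q S) ->
  supported p x -> supported q (bd x).
Proof.
move=> pq px S; rewrite ffunE => nz.
have [v /andP[vS /px/pq->] //|nov] :=
  pickP [pred v | (v \notin S) && (x (v |: S) != 0)].
rewrite big1 ?eqxx // in nz => v vS.
by have /= := nov v; rewrite vS /= => /negbFE/eqP->; rewrite mulr0.
Qed.

(** [del] keeps the sets avoiding [v]; [link] is the contraction by [v], whose
    sign makes [x = del v x + wedge v (link v x)]. *)
Definition del v x : M := [ffun S : {set 'I_n} => if v \in S then 0 else x S].
Definition link v x : M :=
  [ffun S : {set 'I_n} => if v \in S then 0 else vsign v S * x (v |: S)].

Lemma del_link v x : x = del v x + wedge v (link v x).
Proof.
apply/ffunP => S; rewrite !ffunE; case: ifP => [vS|_]; last by rewrite addr0.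
rewrite setD11 setD1K // mulrA.
have -> : vsign v S = vsign v (S :\ v).
  by rewrite -{1}(setD1K vS) vsign_add ?setD11 // ltnn mul1r.
by rewrite vsign2 mul1r add0r.
Qed.

Definition avoids v : pred {set 'I_n} := fun S => v \notin S.

Lemma avoids_bd v x : supported (avoids v) x -> supported (avoids v) (bd x).
Proof. by apply: supported_bd => u S _; rewrite /avoids /= !inE negb_or => /andP[]. Qed.

Lemma supported_del v p x :
  supported p x -> supported [pred S : {set 'I_n} | p S && (v \notin S)] (del v x).
Proof.
move=> px S; rewrite ffunE /=; case: ifP => [_|_ /px->//].
by rewrite eqxx.
Qed.

Lemma supported_link v p q x : (forall S, v \notin S -> p (v |: S) -> q S) ->
  supported p x -> supported [pred S : {set 'I_n} | q S && (v \notin S)] (link v x).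
Proof.
move=> pq px S; rewrite ffunE /=; case: ifP => [_|/negbT vS].
  by rewrite eqxx.
by rewrite mulf_eq0 negb_or => /andP[_ /px/pq->].
Qed.

(** Comparing the sets that contain [v] and those that do not. *)
Lemma split_uniq v x y : supported (avoids v) x -> supported (avoids v) y ->
  x + wedge v y = 0 -> x = 0 /\ y = 0.
Proof.
move=> vx vy xy0.
have x0 : x = 0.
  apply/ffunP => S; rewrite ffunE; have [vS|nvS] := boolP (v \in S).
    by rewrite (supported_out vx) // /avoids /= vS.
  by move/ffunP/(_ S): xy0; rewrite !ffunE (negPf nvS) addr0.
split=> //; apply/ffunP => S; rewrite ffunE; have [vS|nvS] := boolP (v \in S).
  by rewrite (supported_out vy) // /avoids /= vS.
move/ffunP/(_ (v |: S)): xy0; rewrite x0 !ffunE add0r setU11 setU1K //.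
by move/eqP; rewrite mulf_eq0 signr_eq0 => /eqP.
Qed.

Definition hpart d x : M := [ffun S : {set 'I_n} => if #|S| == d then x S else 0].

Fact hpart_zmod_morphism d : zmod_morphism (hpart d).
Proof.
by move=> x y; apply/ffunP => S; rewrite !ffunE; case: ifP; rewrite ?subrr.
Qed.

HB.instance Definition _ d := GRing.isZmodMorphism.Build M M
  (hpart d) (hpart_zmod_morphism d).

Lemma hpart_id d x : supported [pred S : {set 'I_n} | #|S| == d] x -> hpart d x = x.
Proof.
move=> dx; apply/ffunP => S; rewrite ffunE; case: ifP => // /negbT nd.
by rewrite (supported_out dx).
Qed.

Lemma hpart_neq0 d e x :
  supported [pred S : {set 'I_n} | #|S| == e] x -> d != e -> hpart d x = 0.
Proof.
move=> ex de; apply/ffunP => S; rewrite !ffunE; case: ifP => // /eqP Sd.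
by rewrite (supported_out ex) //= Sd.
Qed.

Lemma supported_hpart d p x : supported p x ->
  supported [pred S : {set 'I_n} | p S && (#|S| == d)] (hpart d x).
Proof.
by move=> px S; rewrite ffunE /=; case: ifP => [_ /px->//|_]; rewrite eqxx.
Qed.

Lemma hpart_bd d x : hpart d (bd x) = bd (hpart d.+1 x).
Proof.
apply/ffunP => S; rewrite !ffunE; case: ifP => [/eqP Sd|Sd].
  by apply: eq_bigr => v vS; rewrite ffunE cardsU1 vS Sd eqxx.
by rewrite big1 // => v vS; rewrite ffunE cardsU1 vS eqSS Sd mulr0.
Qed.

End Exterior.

(** * Independent sets of a path *)

Section Paths.
Variable N : nat.
Local Notation M := {ffun {set 'I_N.+1} -> int}.
Implicit Types (S T : {set 'I_N.+1}) (u v : 'I_N.+1) (x y z w : M) (a b m : nat).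

Definition path_indep a b : pred {set 'I_N.+1} := fun S =>
  [forall u in S, (a <= u < b)%N] &&
  [forall u in S, forall v in S, (v : nat) != u.+1].

Lemma path_indepP a b S :
  reflect ((forall u, u \in S -> (a <= u < b)%N) /\
           (forall u v, u \in S -> v \in S -> (v : nat) <> u.+1))
          (path_indep a b S).
Proof.
apply: (iffP andP) => -[range indep]; split.
- by move=> u uS; apply: (forall_inP range).
- move=> u v uS vS; apply/eqP.
  exact: (forall_inP (forall_inP indep u uS)).
- by apply/forall_inP.
by apply/forall_inP => u uS; apply/forall_inP => v vS; apply/eqP/indep.
Qed.

Lemma path_indep0 a b : path_indep a b set0.
Proof. by apply/path_indepP; split=> u; rewrite inE. Qed.

Lemma path_indep_widen a b a' b' S : (a' <= a)%N -> (b <= b')%N ->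
  path_indep a b S -> path_indep a' b' S.
Proof.
move=> aa bb /path_indepP[range indep]; apply/path_indepP; split=> // u /range.
by lia.
Qed.

(** If [a.+1] is used then its neighbours [a] and [a.+2] are not, so that the
    rest lives on the path starting at [a.+3]. *)
Lemma path_indep_link a b v S : (v : nat) = a.+1 -> v \notin S ->
  path_indep a b (v |: S) -> path_indep a.+3 b S.
Proof.
move=> va vS /path_indepP[range indep].
apply/path_indepP; split=> [u uS|u w uS wS]; last first.
  by apply: indep; rewrite !inE ?uS ?wS orbT.
have uvS : u \in v |: S by rewrite !inE uS orbT.
have vvS : v \in v |: S by rewrite !inE eqxx.
have uv : (u : nat) <> v by move/val_inj => uv; rewrite -uv uS in vS.
have := range u uvS; have := indep _ _ uvS vvS; have := indep _ _ vvS uvS.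
by lia.
Qed.

Lemma path_indep_cons a b v S : (a <= v < b)%N -> (v <= a.+1)%N ->
  path_indep a.+3 b S -> path_indep a b (v |: S).
Proof.
move=> av va /path_indepP[range indep]; apply/path_indepP; split=> [u|u w].
  by rewrite !inE => /orP[/eqP->|/range]; lia.
rewrite !inE => /orP[/eqP->|uS] /orP[/eqP->|wS].
- by lia.
- by have := range _ wS; lia.
- by have := range _ uS; lia.
exact: indep.
Qed.

Lemma path_indep_leaf a b v v1 S : (v : nat) = a -> (v1 : nat) = a.+1 ->
  (a < b)%N -> v1 \notin S -> path_indep a b S -> path_indep a b (v |: S).
Proof.
move=> va v1a ab v1S /path_indepP[range indep]; apply/path_indepP; split=> [u|u w].
  by rewrite !inE => /orP[/eqP->|/range]; lia.
rewrite !inE => /orP[/eqP->|uS] /orP[/eqP->|wS].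
- by lia.
- move=> w1; have w_v1 : w = v1 by apply: val_inj; rewrite /= w1 va v1a.
  by rewrite -w_v1 wS in v1S.
- by have := range _ uS; lia.
exact: indep.
Qed.

Lemma path_indep_out a b v S : ~~ (a <= v < b)%N -> path_indep a b S -> v \notin S.
Proof. by move=> av /path_indepP[range _]; apply: contra av => /range. Qed.

Lemma path_indep_empty a b S : (b <= a)%N -> path_indep a b S -> S = set0.
Proof.
move=> ba /path_indepP[range _]; apply/setP => u; rewrite inE.
by apply/negP => /range; lia.
Qed.

(** The product of the cycles [e_(a+1) - e_a], [e_(a+4) - e_(a+3)], ... on the
    path with [m] vertices starting at [a]; when one isolated vertex is left
    at the end, the complex is a cone and the product is replaced by 0. *)
Fixpoint path_cycle m a : M :=
  match m with
  | 0 => [ffun S => (S == set0)%:R]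
  | 1 => 0
  | m'.+2 => let z := path_cycle m'.-1 a.+3 in
             wedge (inord a.+1) z - wedge (inord a) z
  end.

(** The number of factors of [path_cycle m a] when it does not vanish. *)
Definition path_deg m := (m.+1 %/ 3)%N.

Lemma path_ind3 (P : nat -> Prop) :
  P 0%N -> P 1%N -> (forall m, P m.-1 -> P m.+2) -> forall m, P m.
Proof.
move=> P0 P1 PS m; elim: m {-2}m (leqnn m) => [|k IHk] [|[|m]] // lemk.
by apply/PS/IHk; lia.
Qed.

Lemma path_cycle_support m a : (a + m <= N.+1)%N ->
  supported [pred S : {set 'I_N.+1} | path_indep a (a + m) S && (#|S| == path_deg m)]
    (path_cycle m a).
Proof.
elim/path_ind3: m a => [||m IHm] a am.
- move=> S; rewrite ffunE; have [-> _ /=|_] := eqVneq S set0; last by rewrite eqxx.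
  by rewrite cards0 andbT path_indep0.
- exact: supported0.
have {IHm}IHm := IHm a.+3.
have wedgeP v : (a <= v <= a.+1)%N ->
    supported [pred S : {set 'I_N.+1} |
        path_indep a (a + m.+2) S && (#|S| == path_deg m.+2)]
      (wedge v (path_cycle m.-1 a.+3)).
  move=> av; case: m am IHm => [|m] am IHm.
    apply: (@supported_wedge _ _ [pred S | S == set0]) => [S _ /eqP->|S] /=.
      rewrite setU0 cards1 andbT -[[set v]]setU0.
      by apply: path_indep_cons (path_indep0 _ _); lia.
    by rewrite ffunE /=; case: (S == set0); rewrite ?eqxx.
  apply: supported_wedge (IHm _) => [S vS /andP[indepS /eqP cardS]|]; last by lia.
  rewrite /= cardsU1 vS cardS; apply/andP; split; last by rewrite /path_deg; lia.
  apply: path_indep_cons; try lia.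
  by apply: path_indep_widen indepS; lia.
by apply: supportedB; apply: wedgeP; rewrite inordK; lia.
Qed.

Lemma bd_path_cycle m a : bd (path_cycle m a) = 0.
Proof.
elim/path_ind3: m a => [||m IHm] a.
- apply/ffunP => S; rewrite !ffunE big1 // => v vS; rewrite ffunE.
  by case: eqP => [E|]; rewrite ?mulr0 //; have := setU11 v S; rewrite E inE.
- exact: raddf0.
by rewrite [path_cycle _ _]/= raddfB /= !bd_wedge IHm !wedge0 !subr0 subrr.
Qed.

Lemma path_cycle0 m a : (m %% 3 = 1)%N -> path_cycle m a = 0.
Proof.
elim/path_ind3: m a => [||m IHm] a // m1.
have m2 : (m.-1 %% 3 = 1)%N by case: m m1 {IHm} => [|m] /=; lia.
by rewrite [path_cycle _ _]/= IHm // !wedge0 subrr.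
Qed.

(** A cycle [y + e_(a+1) z] with [y], [z] free of [a+1] satisfies [bd y = - z],
    hence differs from [(e_(a+1) - e_a) z] by the boundary of [e_a y]. *)
Lemma path_cycle_span m a x : (0 < m -> a + m <= N.+1)%N ->
  supported (path_indep a (a + m)) x -> bd x = 0 ->
  exists l w, supported (path_indep a (a + m)) w /\
    x = path_cycle m a *~ l + bd w.
Proof.
elim/path_ind3: m a x => [||m IHm] a x am px bx0.
- exists (x set0), 0; split; first exact: supported0.
  rewrite raddf0 addr0; apply/ffunP => S.
  transitivity ((S == set0)%:R *~ x set0 : int).
    have [->|S0] := eqVneq S set0; first by rewrite intz.
    rewrite mul0rz (supported_out px) //.
    by apply: contra S0 => /path_indep_empty->; rewrite ?addn0.
  by rewrite ffunMz ffunE.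
- have {}am := am isT; have va : ((inord a : 'I_N.+1) : nat) = a by rewrite inordK; lia.
  exists 0, (wedge (inord a) x); split.
    apply: supported_wedge px => S vS indepS.
    suff -> : S = set0 by apply: path_indep_cons (path_indep0 _ _); lia.
    apply/setP => u; rewrite inE; apply/negP => uS.
    have /path_indepP[/(_ u uS) ua _] := indepS.
    by case/negP: vS; have -> : inord a = u by apply: val_inj => /=; lia.
  by rewrite mulr0z add0r bd_wedge bx0 raddf0 subr0.
have {}am := am isT; pose va : 'I_N.+1 := inord a; pose vb : 'I_N.+1 := inord a.+1.
have vaE : (va : nat) = a by rewrite inordK; lia.
have vbE : (vb : nat) = a.+1 by rewrite inordK; lia.
pose y := del vb x; pose z := link vb x.
have py := supported_del (v := vb) px.
have pz := supported_link (fun S => @path_indep_link a (a + m.+2) vb S vbE) px.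
have avy : supported (avoids vb) y by apply: sub_supported py => S /andP[].
have avz : supported (avoids vb) z by apply: sub_supported pz => S /andP[].
have [] : bd y + z = 0 /\ - bd z = 0.
  apply: (split_uniq (v := vb)).
  - by apply: supportedD => //; apply: avoids_bd.
  - by apply/supportedN/avoids_bd.
  by rewrite raddfN /= -addrA -bd_wedge -raddfD -del_link.
move=> byz /eqP; rewrite oppr_eq0 => /eqP bz0.
have {}pz : supported (path_indep a.+3 (a.+3 + m.-1)) z.
  apply: sub_supported pz => S /andP[indepS _].
  case: m am {IHm px py} indepS => [|m] am indepS.
    by rewrite (path_indep_empty _ indepS) ?path_indep0 //; lia.
  by apply: path_indep_widen indepS; lia.
have wedge_in v w : (a <= v <= a.+1)%N ->
    supported (path_indep a.+3 (a.+3 + m.-1)) w ->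
    supported (path_indep a (a + m.+2)) (wedge v w).
  move=> av; apply: supported_wedge => S vS indepS.
  case: m am {IHm px py pz} indepS => [|m] am indepS.
    by rewrite (path_indep_empty _ indepS) ?path_indep_cons ?path_indep0 //; lia.
  by apply: path_indep_cons; try lia; apply: path_indep_widen indepS; lia.
have [|l [w [pw zE]]] := IHm a.+3 z _ pz bz0; first by lia.
exists l, (wedge va y + wedge va w - wedge vb w); split.
  apply: supportedB; last by apply: wedge_in => //; lia.
  apply: supportedD; last by apply: wedge_in => //; lia.
  apply: supported_wedge py => S vS /andP[indepS vbS].
  by apply: path_indep_leaf vbE _ vbS indepS; lia.
rewrite {1}(del_link vb x) -/y -/z [path_cycle _ _]/= -/va -/vb mulrzBl.
rewrite -!raddfMz /= raddfB raddfD /= !bd_wedge.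
have -> : path_cycle m.-1 a.+3 *~ l = z - bd w by rewrite zE addrK.
have -> : bd y = - z by apply/eqP; rewrite -addr_eq0 byz.
rewrite !wedgeB !wedgeN.
move: y (wedge vb z) (wedge va z) (wedge vb (bd w)) (wedge va (bd w)) {py avy byz}.
by move=> y b1 b2 b3 b4; apply/ffunP => S; rewrite !ffunE; ring.
Qed.

(** The coefficient of [e_(a+1)] in [path_cycle m a *~ l = bd w] expresses the
    same multiple of the shorter product as a boundary. *)
Lemma path_cycle_free m a (l : int) w : (m %% 3 != 1)%N ->
  (0 < m -> a + m <= N.+1)%N -> supported (path_indep a (a + m)) w ->
  path_cycle m a *~ l = bd w -> l = 0.
Proof.
elim/path_ind3: m a w => [||m IHm] a w m1 // am pw bw.
  move/ffunP/(_ set0): bw; rewrite ffunMz !ffunE eqxx intz big1 // => v _.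
  rewrite (supported_out pw) ?mulr0 //; apply/negP => /path_indep_empty.
  by rewrite addn0 => /(_ (leqnn _))/setP/(_ v); rewrite !inE eqxx.
have {}am := am isT; pose va : 'I_N.+1 := inord a; pose vb : 'I_N.+1 := inord a.+1.
have vaE : (va : nat) = a by rewrite inordK; lia.
have vbE : (vb : nat) = a.+1 by rewrite inordK; lia.
pose y := del vb w; pose z := link vb w.
have py := supported_del (v := vb) pw.
have pz := supported_link (fun S => @path_indep_link a (a + m.+2) vb S vbE) pw.
have avy : supported (avoids vb) y by apply: sub_supported py => S /andP[].
have avz : supported (avoids vb) z by apply: sub_supported pz => S /andP[].
have m1' : (m.-1 %% 3 != 1)%N by case: (m) m1 => [|k] //=; lia.
have am' : (0 < m.-1 -> a.+3 + m.-1 <= N.+1)%N by lia.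
set g := path_cycle m.-1 a.+3.
have avg v : (v < a.+3)%N -> supported (avoids v) g.
  move=> va3; case: (ltnP 0 m.-1) => [/am'/path_cycle_support gs|]; last first.
    rewrite /g; case: m.-1 => // _ S; rewrite ffunE.
    by have [-> _|_] := eqVneq S set0; rewrite /avoids /= ?in_set0 // eqxx.
  apply: sub_supported gs => S /andP[indepS _].
  by apply: path_indep_out indepS; lia.
have [] : - bd y - z - wedge va (g *~ l) = 0 /\ g *~ l + bd z = 0.
  apply: (split_uniq (v := vb)).
  - apply: supportedB; first apply: supportedB => //.
      by apply/supportedN/avoids_bd.
    apply: (@supported_wedge _ _ (avoids vb)) => [S _ vbS|].
      move: vbS; rewrite /avoids !inE negb_or => ->; rewrite andbT; apply/eqP => vab.
      by move: vbE; rewrite vab vaE; lia.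
    by apply/supportedMz/avg; lia.
  - apply: supportedD; last exact: avoids_bd.
    by apply/supportedMz/avg; lia.
  move: bw; rewrite (del_link vb w) -/y -/z raddfD /= bd_wedge [path_cycle _ _]/=.
  rewrite mulrzBl -!raddfMz -/va -/vb -/g wedgeD /=.
  move: (bd y) (wedge va _) (wedge vb _) (wedge vb (bd z)) => b1 b2 b3 b4.
  move=> /eqP; rewrite subr_eq => /eqP->.
  by apply/ffunP => S; rewrite !ffunE; ring.
move=> _ gz; apply: (IHm a.+3 (- z)) => //.
  apply: supportedN; apply: sub_supported pz => S /andP[indepS _].
  case: m am {IHm m1 pw bw m1' am' g avg gz py} indepS => [|m] am indepS.
    by rewrite (path_indep_empty _ indepS) ?path_indep0 //; lia.
  by apply: path_indep_widen indepS; lia.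
by rewrite raddfN /=; apply/eqP; rewrite -addr_eq0 gz.
Qed.
End Paths.

(** * Independent sets of a cycle *)

Lemma ordS_nat n (u : 'I_n) : (ordS u : nat) = if u.+1 == n then 0%N else u.+1.
Proof.
rewrite /=; case: eqVneq => [->|un]; first by rewrite modnn.
by rewrite modn_small //; have := ltn_ord u; lia.
Qed.

Section Cycles.
Variable N : nat.
Hypothesis N_gt2 : (2 < N)%N.
Local Notation M := {ffun {set 'I_N.+1} -> int}.
Implicit Types (S T : {set 'I_N.+1}) (u v : 'I_N.+1) (x y z w : M).

Local Notation cycle_indep :=
  (fun S => S \in independence_complex (@cycle_graph N.+1)).

Lemma cycle_indepP S :
  reflect (forall u v, u \in S -> v \in S ->
             (v : nat) <> u.+1 /\ ~ (u = N :> nat /\ v = 0 :> nat))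
          (S \in independence_complex (@cycle_graph N.+1)).
Proof.
rewrite inE; apply: (iffP forall_inP) => [indep u v uS vS|indep u uS].
  have /forall_inP/(_ v vS) := indep u uS; rewrite /cycle_graph /= negb_or.
  case/andP => /eqP vu _; split=> [E|[uN v0]]; apply: vu; apply: ord_inj;
    rewrite ordS_nat eqSS; have := ltn_ord v; case: eqP; lia.
apply/forall_inP => v vS; rewrite /cycle_graph /= negb_or.
apply/andP; split; apply/eqP => E.
  by have := indep u v uS vS; rewrite E ordS_nat eqSS; case: eqP => [uN [_ []] | _ []].
by have := indep v u vS uS; rewrite E ordS_nat eqSS; case: eqP => [uN [_ []] | _ []].
Qed.

Lemma cycle_indep_sub S T : T \subset S -> cycle_indep S -> cycle_indep T.
Proof.
move=> /subsetP TS /cycle_indepP indep; apply/cycle_indepP => u v /TS uS /TS.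
exact: indep.
Qed.

Lemma cycle_indep_del S : ord_max \notin S -> cycle_indep S -> path_indep 0 N S.
Proof.
move=> NS /cycle_indepP indep; apply/path_indepP; split=> [u uS|u v uS vS].
  have : (u : nat) <> N.
    by move=> uN; case/negP: NS; have <- : u = ord_max by apply: val_inj.
  by have := ltn_ord u; lia.
exact: (proj1 (indep u v uS vS)).
Qed.

Lemma cycle_indep_link S : ord_max \notin S -> cycle_indep (ord_max |: S) ->
  path_indep 1 (1 + (N - 2)) S.
Proof.
move=> NS indepN.
have /path_indepP[range indep] : path_indep 0 N S.
  by apply: cycle_indep_del NS (cycle_indep_sub (subsetUr _ _) indepN).
apply/path_indepP; split=> // u uS; have := range u uS.
have [uN vN] : u \in ord_max |: S /\ (ord_max : 'I_N.+1) \in ord_max |: S.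
  by rewrite !inE uS eqxx orbT.
have /cycle_indepP indep' := indepN.
have [] := indep' _ _ uN vN; have [] := indep' _ _ vN uN; rewrite /=.
by lia.
Qed.

Lemma path_indep_cycle S : path_indep 0 N S -> cycle_indep S.
Proof.
move=> /path_indepP[range indep]; apply/cycle_indepP => u v uS vS.
split; first exact: indep.
by have := range u uS; lia.
Qed.

Lemma cycle_indep_cons S : path_indep 1 (1 + (N - 2)) S -> cycle_indep (ord_max |: S).
Proof.
move=> /path_indepP[range indep]; apply/cycle_indepP => u v.
rewrite !inE => /orP[/eqP->|uS] /orP[/eqP->|vS] /=.
- by lia.
- by have := range v vS; lia.
- by have := range u uS; lia.
by have := range u uS; have := indep u v uS vS; lia.
Qed.

(** The generator of the path left by the last vertex bounds in the path
    obtained by deleting that vertex: the generator of the latter has another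
    degree or vanishes.  This is what makes it extend to a cycle of the polygon. *)
Lemma path_cycle_bounding : exists y,
  [/\ supported [pred S | path_indep 0 N S && (#|S| == (path_deg (N - 2)).+1)] y,
      bd y = path_cycle N (N - 2) 1 & path_cycle N (N - 2) 1 = 0 -> y = 0].
Proof.
pose g : M := path_cycle N (N - 2) 1.
have [g0|gN0] := eqVneq g 0.
  by exists 0; split=> //; [apply: supported0|rewrite raddf0].
have gs := @path_cycle_support N (N - 2) 1 ltac:(lia).
have [|||l [w [pw gE]]] := @path_cycle_span N N 0 g.
- by lia.
- by apply: sub_supported gs => S /andP[indepS _]; apply: path_indep_widen indepS; lia.
- exact: bd_path_cycle.
exists (hpart (path_deg (N - 2)).+1 w); split; last by move/eqP; rewrite (negPf gN0).
  exact: supported_hpart.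
rewrite -hpart_bd; have -> : bd w = g - path_cycle N N 0 *~ l by rewrite gE addrC addKr.
rewrite raddfB /= hpart_id; last by apply: sub_supported gs => S /andP[].
have [N1|N1] := eqVneq (N %% 3)%N 1%N.
  by rewrite path_cycle0 // mul0rz raddf0 subr0.
have Ns := @path_cycle_support N N 0 ltac:(lia).
rewrite (@hpart_neq0 _ _ (path_deg N)) ?subr0 //.
  by apply: supportedMz; apply: sub_supported Ns => S /andP[].
have : ((N - 2) %% 3 != 1)%N; last by rewrite /path_deg; lia.
by apply: contraNneq gN0 => N21; apply/eqP/path_cycle0.
Qed.

(** With [N] the last vertex, [x1] is the generator of the path that avoids it
    and [x2 = e_N g - y], where [g] generates the path of vertices not adjacent
    to it and [bd y = g].  A cycle or a bounding chain of the polygon is cut into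
    its parts with and without [N]. *)
Theorem cycle_complex_generators : exists x1 x2 : M,
  [/\ supported [pred S | cycle_indep S && (#|S| == N.+1 %/ 3)%N] x1 /\ bd x1 = 0,
      supported [pred S | cycle_indep S && (#|S| == N.+2 %/ 3)%N] x2 /\ bd x2 = 0,
      ((N.+1 %% 3 = 2)%N -> x1 = 0) /\ ((N.+1 %% 3 = 1)%N -> x2 = 0),
      forall x, supported cycle_indep x -> bd x = 0 ->
        exists l1 l2 w, supported cycle_indep w /\
          x = x1 *~ l1 + x2 *~ l2 + bd w &
      forall l1 l2 w, supported cycle_indep w ->
        x1 *~ l1 + x2 *~ l2 = bd w ->
        ((N.+1 %% 3 != 2)%N -> l1 = 0) /\ ((N.+1 %% 3 != 1)%N -> l2 = 0)].
Proof.
pose g1 : M := path_cycle N N 0; pose g2 : M := path_cycle N (N - 2) 1.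
have [y0 [y0s by0 y00]] := path_cycle_bounding.
have g1s := @path_cycle_support N N 0 ltac:(lia).
have g2s := @path_cycle_support N (N - 2) 1 ltac:(lia).
pose vN : 'I_N.+1 := ord_max.
exists g1, (wedge vN g2 - y0); split.
- split; last exact: bd_path_cycle.
  apply: sub_supported g1s => S /andP[/path_indep_cycle indepS /eqP cardS].
  by apply/andP; split; [exact: indepS | rewrite cardS].
- split; last by rewrite raddfB /= bd_wedge bd_path_cycle wedge0 subr0 by0 subrr.
  apply: supportedB.
    apply: supported_wedge g2s => S NS /andP[/cycle_indep_cons indepS /eqP cardS].
    apply/andP; split; [exact: indepS | apply/eqP].
    by rewrite cardsU1 NS cardS /path_deg; lia.
  apply: sub_supported y0s => S /andP[/path_indep_cycle indepS /eqP cardS].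
  by apply/andP; split; [exact: indepS | rewrite cardS /path_deg; lia].
- split=> N3; first by apply: path_cycle0; lia.
  have g20 : g2 = 0 by apply: path_cycle0; lia.
  by rewrite y00 // g20 wedge0 subr0.
- move=> x cx bx0; pose y := del vN x; pose z := link vN x.
  have cy : supported (path_indep 0 N) y.
    apply: sub_supported (supported_del (v := vN) cx) => S /andP[cS NS].
    exact: cycle_indep_del.
  have cz : supported (path_indep 1 (1 + (N - 2))) z.
    apply: sub_supported (supported_link (fun S => @cycle_indep_link S) cx) => S.
    by case/andP.
  have avy : supported (avoids vN) y.
    by apply: sub_supported cy => S; apply: path_indep_out; rewrite /= ltnn.
  have avz : supported (avoids vN) z.
    by apply: sub_supported cz => S; apply: path_indep_out; rewrite /=; lia.
  have [] : bd y + z = 0 /\ - bd z = 0.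
    apply: (split_uniq (v := vN)).
    - by apply: supportedD => //; apply: avoids_bd.
    - by apply/supportedN/avoids_bd.
    by rewrite wedgeN -addrA -bd_wedge -raddfD -del_link.
  move=> byz /eqP; rewrite oppr_eq0 => /eqP bz0.
  have [|l2 [w2 [cw2 zE]]] := path_cycle_span _ cz bz0; first by lia.
  pose y' := y + w2 + y0 *~ l2.
  have cy' : supported (path_indep 0 N) y'.
    apply: supportedD; first apply: supportedD => //.
      by apply: sub_supported cw2 => S; apply: path_indep_widen; lia.
    by apply: supportedMz; apply: sub_supported y0s => S /andP[].
  have by' : bd y' = 0.
    rewrite /y' !raddfD raddfMz /= by0 -/g2.
    by rewrite -addrA [bd w2 + _]addrC -zE byz.
  have [|l1 [w1 [cw1 y'E]]] := path_cycle_span _ cy' by'; first by lia.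
  exists l1, l2, (w1 - wedge vN w2); split.
    apply: supportedB; first by apply: sub_supported cw1 => S /path_indep_cycle.
    by apply: supported_wedge cw2 => S _ /cycle_indep_cons.
  rewrite {1}(del_link vN x) -/y -/z raddfB /= bd_wedge mulrzBl -raddfMz /= -/g2.
  have -> : g2 *~ l2 = z - bd w2 by rewrite zE addrK.
  have -> : y = y' - y0 *~ l2 - w2 by rewrite /y' !addrK.
  rewrite wedgeB y'E -/g1.
  move: (bd w1) (g1 *~ l1) (y0 *~ l2) (wedge vN z) (wedge vN (bd w2)).
  by move=> b1 b2 b3 b4 b5; apply/ffunP => S; rewrite !ffunE; ring.
move=> l1 l2 w cw E; pose y := del vN w; pose z := link vN w.
have cy : supported (path_indep 0 N) y.
  apply: sub_supported (supported_del (v := vN) cw) => S /andP[cS NS].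
  exact: cycle_indep_del.
have cz : supported (path_indep 1 (1 + (N - 2))) z.
  apply: sub_supported (supported_link (fun S => @cycle_indep_link S) cw) => S.
  by case/andP.
have avy : supported (avoids vN) y.
  by apply: sub_supported cy => S; apply: path_indep_out; rewrite /= ltnn.
have avz : supported (avoids vN) z.
  by apply: sub_supported cz => S; apply: path_indep_out; rewrite /=; lia.
have avg1 : supported (avoids vN) g1.
  apply: sub_supported g1s => S /andP[indepS _].
  by apply: path_indep_out indepS; rewrite /= ltnn.
have avg2 : supported (avoids vN) g2.
  apply: sub_supported g2s => S /andP[indepS _].
  by apply: path_indep_out indepS; rewrite /=; lia.
have avy0 : supported (avoids vN) y0.
  apply: sub_supported y0s => S /andP[indepS _].
  by apply: path_indep_out indepS; rewrite /= ltnn.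
have [] : g1 *~ l1 - y0 *~ l2 - (bd y + z) = 0 /\ g2 *~ l2 + bd z = 0.
  apply: (split_uniq (v := vN)).
  - apply: supportedB; last by apply: supportedD => //; apply: avoids_bd.
    by apply: supportedB; apply: supportedMz.
  - by apply: supportedD; [apply: supportedMz | apply: avoids_bd].
  move: E; rewrite {1}(del_link vN w) -/y -/z raddfD /= bd_wedge mulrzBl -raddfMz /=.
  move/eqP; rewrite -subr_eq0 => /eqP E0; rewrite -[RHS]E0 wedgeD.
  move: (bd y) (wedge vN (bd z)) (wedge vN (g2 *~ l2)) (g1 *~ l1) (y0 *~ l2).
  by move=> b1 b2 b3 b4 b5; apply/ffunP => S; rewrite !ffunE; ring.
move=> E1 E2.
have l20 : (N.+1 %% 3 != 1)%N -> l2 = 0.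
  move=> N3; apply: (@path_cycle_free N (N - 2) 1 l2 (- z)); try lia.
    exact: supportedN.
  by rewrite raddfN /=; apply/eqP; rewrite -addr_eq0 E2.
have [g2l2 y0l2] : g2 *~ l2 = 0 /\ y0 *~ l2 = 0.
  have [N3|/l20->] := eqVneq (N.+1 %% 3)%N 1%N; last by rewrite !mulr0z.
  have g20 : g2 = 0 by apply: path_cycle0; lia.
  by rewrite g20 y00 // !mul0rz.
split=> // N3.
have bz0 : bd z = 0 by rewrite -E2 g2l2 add0r.
have [|l [w2 [cw2 zE]]] := path_cycle_span _ cz bz0; first by lia.
apply: (@path_cycle_free N N 0 l1 (y + (y0 *~ l + w2))); try lia.
  apply: supportedD => //; apply: supportedD.
    by apply: supportedMz; apply: sub_supported y0s => S /andP[].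
  by apply: sub_supported cw2 => S; apply: path_indep_widen; lia.
rewrite !raddfD raddfMz /= by0 -zE.
by move/eqP: E1; rewrite y0l2 subr0 subr_eq0 => /eqP.
Qed.

End Cycles.

(** * From supported functions to reduced simplicial homology *)

Section ReducedHomology.
Variables (n : nat) (K : {set {set 'I_n}}).
Hypothesis K_sub : forall S T : {set 'I_n}, T \subset S -> S \in K -> T \in K.
Local Notation M := {ffun {set 'I_n} -> int}.
Local Notation in_K := (fun S : {set 'I_n} => S \in K).

Lemma bd_face_sign (x : M) T : bd x T = \sum_S x S * face_sign S T.
Proof.
rewrite ffunE /face_sign.
under [RHS]eq_bigr do rewrite mulr_sumr.
rewrite (exchange_big_dep predT) //= [RHS](bigID (fun v => v \notin T)) /=.
rewrite [X in _ = _ + X]big1 ?addr0 => [|v /negPn vT]; last first.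
  rewrite big1 // => S /andP[_ /eqP E].
  by move: vT; rewrite E !inE eqxx.
apply: eq_bigr => v vT; rewrite (big_pred1 (v |: T)) => [|S] /=.
  by rewrite -/(vsign v (v |: T)) vsign_add // ltnn mul1r mulrC.
apply/andP/eqP => [[vS /eqP->]|->]; first by rewrite setD1K.
by rewrite setU11 setU1K.
Qed.

(** Chains of any subset of the simplices, seen in the exterior algebra. *)
Definition extend P (c : @chain {set 'I_n} P) : M :=
  [ffun S : {set 'I_n} => coef c S].

Fact extend_zmod_morphism P : zmod_morphism (@extend P).
Proof. by move=> c d; apply/ffunP => S; rewrite !ffunE coef_sub. Qed.

HB.instance Definition _ P := GRing.isZmodMorphism.Build (chain P) M
  (@extend P) (@extend_zmod_morphism P).

Lemma extend_supported P (c : chain P) : supported P (extend c).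
Proof. by move=> S; rewrite ffunE; apply: contraNT => /coef_out->. Qed.

Lemma extend_of_coef P (x : M) : supported P x -> extend (of_coef P x) = x.
Proof.
move=> Px; apply/ffunP => S; rewrite ffunE coef_of_coef.
by case: ifP => // /negbT nPS; rewrite (supported_out Px).
Qed.

Lemma extend_inj P : injective (@extend P).
Proof. by move=> c d /ffunP cd; apply: eq_coef => S; have := cd S; rewrite !ffunE. Qed.

Lemma extend_boundary d e (c : chain (simplex_of_dim K d)) : e = d - 1 ->
  extend (boundary (@face_sign n) (simplex_of_dim K e) c) = bd (extend c).
Proof.
move=> ->; apply/ffunP => T; rewrite ffunE coef_boundary bd_face_sign.
under [RHS]eq_bigr do rewrite ffunE.
case: ifP => // /negbT nT.
have bs : supported (simplex_of_dim K (d - 1)) (bd (extend c)).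
  apply: supported_bd (@extend_supported _ c).
  move=> v S vS /andP[SK /eqP <-].
  apply/andP; split; first exact: K_sub (subsetUr _ _) SK.
  by rewrite cardsU1 vS add1n -addn1 PoszD addrK.
have := supported_out bs nT; rewrite bd_face_sign => E.
by rewrite -[LHS]E; apply: eq_bigr => S _; rewrite ffunE.
Qed.

(** Because [bd] lowers the size by one, exactness up to arbitrary chains of
    [K] in one degree only involves the homogeneous part of the next degree. *)
Lemma reduced_homology_free (B : zmodType) (s : nat) (d : int)
    (gen : {additive B -> M}) : d = s%:Z - 1 ->
  (forall b, supported [pred S : {set 'I_n} | (S \in K) && (#|S| == s)] (gen b)) ->
  (forall b, bd (gen b) = 0) ->
  (forall x, supported [pred S : {set 'I_n} | (S \in K) && (#|S| == s)] x ->
     bd x = 0 -> exists b w, supported in_K w /\ x = gen b + bd w) ->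
  (forall b w, supported in_K w -> gen b = bd w -> b = 0) ->
  zmod_iso (reduced_homology K d) B.
Proof.
move=> def_d gen_s bd_gen span free.
have dimE S : simplex_of_dim K d S = (S \in K) && (#|S| == s).
  by rewrite /simplex_of_dim /= def_d; congr (_ && _); apply/eqP/eqP; lia.
have gen_d b : supported (simplex_of_dim K d) (gen b).
  by apply: sub_supported (gen_s b) => S; rewrite dimE.
have sB : zmod_morphism (fun b => of_coef (simplex_of_dim K d) (gen b)).
  by move=> a b; apply: extend_inj; rewrite [RHS]raddfB /= !extend_of_coef // raddfB.
pose A := GRing.isZmodMorphism.Build B (chain (simplex_of_dim K d)) _ sB.
pose sa : {additive B -> chain (simplex_of_dim K d)} := 
  HB.pack (fun b => of_coef (simplex_of_dim K d) (gen b)) A.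
apply: (@homology_free _ _ _ _ _ _ sa) => [b|c bc|b u E].
- apply: extend_inj; rewrite extend_boundary // extend_of_coef // bd_gen.
  by rewrite raddf0.
- have bdc : bd (extend c) = 0.
    by rewrite -(extend_boundary c (erefl (d - 1))) bc raddf0.
  have cs : supported [pred S : {set 'I_n} | (S \in K) && (#|S| == s)] (extend c).
    by apply: sub_supported (@extend_supported _ c) => S; rewrite dimE.
  have [b [w [Kw cE]]] := span _ cs bdc.
  have Pw : supported (simplex_of_dim K (d + 1)) (hpart s.+1 w).
    apply: sub_supported (@supported_hpart n s.+1 _ _ Kw) => S /andP[SK /eqP cardS].
    by rewrite /simplex_of_dim /= SK cardS def_d; apply/eqP; lia.
  exists b, (of_coef _ (hpart s.+1 w)); apply: extend_inj.
  rewrite raddfD /= extend_of_coef // extend_boundary ?addrK // extend_of_coef //.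
  rewrite -hpart_bd -(hpart_id (d := s) (x := gen b)); last first.
    by apply: sub_supported (gen_s b) => S /andP[].
  by rewrite -raddfD /= -cE hpart_id // => S /cs/andP[].
apply: (free b (extend u)).
  by apply: sub_supported (@extend_supported _ u) => S /andP[].
rewrite -[gen b](extend_of_coef (gen_d b)) -(extend_boundary (e := d)) ?addrK //.
by congr extend.
Qed.

(** The dimensions below -1, where there are no simplices, are included. *)
Lemma reduced_homology_trivial (d : int) :
  (forall s x, d = s%:Z - 1 ->
     supported [pred S : {set 'I_n} | (S \in K) && (#|S| == s)] x ->
     bd x = 0 -> exists w, supported in_K w /\ x = bd w) ->
  trivial_zmod (reduced_homology K d).
Proof.
move=> span; apply: homology_trivial => c bc.
have [d_ge|d_lt] := leP 0 (d + 1); last first.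
  exists 0; rewrite raddf0; apply: extend_inj; rewrite raddf0; apply/ffunP => S.
  rewrite ffunE (supported_out (@extend_supported _ c)) //.
  by apply/negP => /andP[_ /eqP]; lia.
have [s def_d] : exists s : nat, d = s%:Z - 1 by exists (absz (d + 1)); lia.
have dimE S : simplex_of_dim K d S = (S \in K) && (#|S| == s).
  by rewrite /simplex_of_dim /= def_d; congr (_ && _); apply/eqP/eqP; lia.
have bdc : bd (extend c) = 0.
  by rewrite -(extend_boundary c (erefl (d - 1))) bc raddf0.
have cs : supported [pred S : {set 'I_n} | (S \in K) && (#|S| == s)] (extend c).
  by apply: sub_supported (@extend_supported _ c) => S; rewrite dimE.
have [w [Kw cE]] := span _ _ def_d cs bdc.
have Pw : supported (simplex_of_dim K (d + 1)) (hpart s.+1 w).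
  apply: sub_supported (@supported_hpart n s.+1 _ _ Kw) => S /andP[SK /eqP cardS].
  by rewrite /simplex_of_dim /= SK cardS def_d; apply/eqP; lia.
exists (of_coef _ (hpart s.+1 w)); apply: extend_inj.
rewrite extend_boundary ?addrK // extend_of_coef // -hpart_bd -cE.
by rewrite hpart_id // => S /cs/andP[].
Qed.

End ReducedHomology.

(** In [cycle_complex_generators] the generators [x1] and [x2] sit in the degrees
    [n %/ 3] and [n.+1 %/ 3], which agree when 3 divides [n]; otherwise exactly
    one of them vanishes. *)
Theorem reduced_homology_cycle (n : nat) (d k : int) : (3 < n)%N ->
  [/\ n%:Z = 3 * k + 1 \/ n%:Z = 3 * k - 1 -> d = k - 1 ->
        zmod_iso (reduced_homology (independence_complex (@cycle_graph n)) d) int,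
      n%:Z = 3 * k -> d = k - 1 ->
        zmod_iso (reduced_homology (independence_complex (@cycle_graph n)) d)
                 (int * int)%type &
      n%:Z = 3 * k \/ n%:Z = 3 * k + 1 \/ n%:Z = 3 * k - 1 -> d <> k - 1 ->
        trivial_zmod (reduced_homology (independence_complex (@cycle_graph n)) d)].
Proof.
case: n => [//|N] N_gt2; set K := independence_complex _.
have {N_gt2}N_gt2 : (2 < N)%N by [].
have K_sub (S T : {set 'I_N.+1}) : T \subset S -> S \in K -> T \in K.
  by move=> TS; apply: cycle_indep_sub TS.
have [x1 [x2 [[x1s bx1] [x2s bx2] [x10 x20] span free]]] :=
  cycle_complex_generators N_gt2.
have spanK s x : supported [pred S : {set 'I_N.+1} | (S \in K) && (#|S| == s)] x ->
    bd x = 0 -> exists l1 l2 w, supported (fun S : {set 'I_N.+1} => S \in K) w /\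
      x = x1 *~ l1 + x2 *~ l2 + bd w.
  by move=> xs; apply: span => S /xs/andP[].
have rank1 x s :
    supported [pred S : {set 'I_N.+1} | (S \in K) && (#|S| == s)] x -> bd x = 0 ->
    (forall y, supported [pred S : {set 'I_N.+1} | (S \in K) && (#|S| == s)] y ->
      bd y = 0 -> exists l w, supported (fun S : {set 'I_N.+1} => S \in K) w /\
        y = x *~ l + bd w) ->
    (forall l w, supported (fun S : {set 'I_N.+1} => S \in K) w ->
      x *~ l = bd w -> l = 0) -> zmod_iso (reduced_homology K (s%:Z - 1)) int.
  move=> xs bx0 spanx freex.
  have gB : zmod_morphism (fun l : int => x *~ l) by move=> a b; exact: mulrzBr.
  pose A := GRing.isZmodMorphism.Build int {ffun {set 'I_N.+1} -> int} _ gB.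
  pose gen : {additive int -> {ffun {set 'I_N.+1} -> int}} :=
    HB.pack (fun l : int => x *~ l) A.
  apply: (@reduced_homology_free _ K K_sub int s _ gen) => // l.
    exact: supportedMz.
  by rewrite /= raddfMz /= bx0 mul0rz.
split.
- move=> Nk ->; have [N2|N2] := eqVneq (N.+1 %% 3)%N 2%N.
    have -> : k = (N.+2 %/ 3)%N%:Z by lia.
    apply: rank1 x2s bx2 _ _ => [y ys by0|l w Kw E].
      have [l1 [l2 [w [Kw yE]]]] := spanK _ _ ys by0.
      by exists l2, w; rewrite yE x10 // mul0rz add0r.
    have E' : x1 *~ 0 + x2 *~ l = bd w by rewrite mulr0z add0r.
    by have [_ l0] := free _ _ _ Kw E'; apply: l0; rewrite N2.
  have N1 : (N.+1 %% 3 = 1)%N by lia.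
  have -> : k = (N.+1 %/ 3)%N%:Z by lia.
  apply: rank1 x1s bx1 _ _ => [y ys by0|l w Kw E].
    have [l1 [l2 [w [Kw yE]]]] := spanK _ _ ys by0.
    by exists l1, w; rewrite yE x20 // mul0rz addr0.
  have E' : x1 *~ l + x2 *~ 0 = bd w by rewrite mulr0z addr0.
  by have [l0 _] := free _ _ _ Kw E'; apply: l0; rewrite N1.
- move=> Nk ->; have N0 : (N.+1 %% 3 = 0)%N by lia.
  have gB : zmod_morphism (fun l : int * int => x1 *~ l.1 + x2 *~ l.2).
    by move=> a b; rewrite /= !mulrzBr opprD addrACA.
  pose A := GRing.isZmodMorphism.Build
    (int * int)%type {ffun {set 'I_N.+1} -> int} _ gB.
  pose gen : {additive (int * int)%type -> {ffun {set 'I_N.+1} -> int}} :=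
    HB.pack (fun l : int * int => x1 *~ l.1 + x2 *~ l.2) A.
  pose s := (N.+1 %/ 3)%N.
  have s2 : (N.+2 %/ 3)%N = s by rewrite /s; lia.
  apply: (@reduced_homology_free _ K K_sub _ s _ gen) => [|l|l|y ys by0|[l1 l2] w Kw E].
  + by rewrite /s; lia.
  + by apply: supportedD; apply: supportedMz => //; rewrite -s2.
  + by rewrite /= raddfD !raddfMz /= bx1 bx2 !mul0rz addr0.
  + have [l1 [l2 [w [Kw yE]]]] := spanK _ _ ys by0.
    by exists (l1, l2), w.
  have [l10 l20] := free l1 l2 w Kw E.
  by rewrite l10 ?l20 ?N0.
move=> Nk dk; apply: (reduced_homology_trivial K_sub) => s x def_d xs bx0.
have [l1 [l2 [w [Kw xE]]]] := spanK _ _ xs bx0.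
exists (hpart s.+1 w); split.
  by apply: sub_supported (@supported_hpart _ s.+1 _ _ Kw) => S /andP[].
rewrite -hpart_bd; have -> : bd w = x - (x1 *~ l1 + x2 *~ l2).
  by rewrite xE addrC addKr.
have hpart0 y r : (s != r)%N ->
    supported [pred S : {set 'I_N.+1} | (S \in K) && (#|S| == r)] y ->
    hpart s y = 0.
  by move=> sr ys; apply: hpart_neq0 sr => S /ys/andP[].
have hx1 : hpart s x1 = 0.
  have [N2|N2] := eqVneq (N.+1 %% 3)%N 2%N; first by rewrite x10 // raddf0.
  by apply: hpart0 x1s; lia.
have hx2 : hpart s x2 = 0.
  have [N1|N1] := eqVneq (N.+1 %% 3)%N 1%N; first by rewrite x20 // raddf0.
  by apply: hpart0 x2s; lia.
rewrite raddfB raddfD /= !raddfMz /= hx1 hx2 !mul0rz addr0 subr0.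
by rewrite hpart_id // => S /xs/andP[].
Qed.
(** * Counting connected components *)

Section Components.
Variable T : finType.
Implicit Types e : rel T.

Lemma connect_invariant e (U : Type) (F : T -> U) :
  (forall x y, e x y -> F x = F y) -> forall x y, connect e x y -> F x = F y.
Proof.
move=> Fe x y /connectP[p]; elim: p x => [|z p IHp] x /=; first by move=> _ ->.
by case/andP=> /Fe-> ep /(IHp _ ep).
Qed.

(** A function constant on components separates at least as many components as
    it has values. *)
Lemma card_roots_ge e (U : finType) (F : T -> U) (A : {set U}) : symmetric e ->
  (forall x y, e x y -> F x = F y) -> (forall u, u \in A -> exists x, F x = u) ->
  (#|A| <= #|roots e|)%N.
Proof.
move=> e_sym Fe surj.
apply: leq_trans (leq_imset_card F (roots e)); apply/subset_leq_card/subsetP.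
move=> u /surj[x <-]; apply/imsetP; exists (fingraph.root e x).
  exact: roots_root (sym_connect_sym e_sym) x.
exact/(connect_invariant Fe)/connect_root.
Qed.

Lemma card_roots_le1 e (F := fingraph.root e) x0 :
  (forall x, F x = F x0) -> (#|roots e| <= 1)%N.
Proof.
move=> Fx0; rewrite -(cards1 (F x0)); apply/subset_leq_card/subsetP => x.
by rewrite inE => /eqP <-; apply/eqP/Fx0.
Qed.

(** If [e] only joins what the components of [e'] join once those of [a] and [b]
    are identified, then it has at most one component less than [e']. *)
Lemma card_roots_merge e e' a b (R := fingraph.root e') :
    symmetric e -> symmetric e' ->
  (forall x y, e x y ->
     (if R x == R b then R a else R x) = (if R y == R b then R a else R y)) ->
  (#|roots e'| <= #|roots e|.+1)%N.
Proof.
move=> e_sym e'_sym Fe.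
have Rroots x : x \in roots e' -> R x = x by move/eqP.
have le_e : (#|[set x in roots e'] :\ R b| <= #|roots e|)%N.
  apply: (card_roots_ge e_sym Fe) => u; rewrite !inE => /andP[uRb /Rroots Ru].
  by exists u; rewrite Ru (negPf uRb).
by rewrite -cardsE (cardsD1 (R b)); case: (_ \in _); lia.
Qed.

End Components.

(** * Circles in the smoothings of an alternating closed 3-braid *)

Lemma odd_ordS n (u : 'I_n) : ~~ odd n -> odd (ordS u) = ~~ odd u.
Proof.
rewrite ordS_nat; case: eqP => [un|_ _] //.
by have /= -> := congr1 odd un; move=> /negPf ->.
Qed.

Section Circles.
Variable w : seq 'I_2.
Local Notation N := (size w).
Hypothesis letterE : forall t : 'I_N, (letter t : nat) = ~~ odd t.
Hypothesis N_even : ~~ odd N.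
Hypothesis N_gt3 : (3 < N)%N.
Local Notation D := (braid_closure w).
Local Notation A := (braid_arc w).
Implicit Types (S : {set 'I_N}) (t c : 'I_N) (p : 'I_3).

Definition mid : 'I_3 := lift ord0 ord0.

(** The crossing [t] exchanges the positions [mid] and [out t]. *)
Definition out t : 'I_3 := if odd t then ord0 else ord_max.
Definition side t : 'I_3 := if odd t then ord_max else ord0.

Lemma position t p : [\/ p = mid, p = out t | p = side t].
Proof.
have : (p < 3)%N by [].
rewrite /out /side; case: (odd t); case: p => [[|[|[|//]]] p3] _ /=;
  by [constructor 1; apply: ord_inj | constructor 2; apply: ord_inj
     | constructor 3; apply: ord_inj].
Qed.

Lemma out_mid t : (out t == mid) = false.
Proof. by rewrite /out; case: odd. Qed.
Lemma side_mid t : (side t == mid) = false.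
Proof. by rewrite /side; case: odd. Qed.
Lemma side_out t : (side t == out t) = false.
Proof. by rewrite /side /out; case: odd. Qed.
Lemma out_ordS t : out (ordS t) = side t.
Proof. by rewrite /out /side odd_ordS //; case: odd. Qed.
Lemma side_ordS t : side (ordS t) = out t.
Proof. by rewrite /out /side odd_ordS //; case: odd. Qed.

Lemma letter_ends t :
  (low (letter t) = out t /\ high (letter t) = mid) \/
  (low (letter t) = mid /\ high (letter t) = out t).
Proof.
rewrite /out; have := letterE t; case: (odd t) => /= lt; [left | right];
  by split; apply: ord_inj; rewrite /= /bump /= lt.
Qed.

Definition smoothed S : state D := [ffun c => label_of_bool (c \notin S)].

Definition circle_rel S : rel A :=
  [rel x y | joined (smoothed S) x y || joined (smoothed S) y x].

Lemma circle_rel_sym S : symmetric (circle_rel S).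
Proof. by move=> x y; apply: orbC. Qed.

(** The arcs joined by the closure, beside a crossing, by an A-smoothing and by a
    B-smoothing, in this order.  Taking for [F] the component of an arc turns
    connectivity questions into equational reasoning. *)
Definition circle_invariant S (U : Type) (F : A -> U) : Prop :=
  [/\ forall p, F (ord_max, p) = F (ord0, p),
      forall t, F (low t, side t) = F (high t, side t),
      forall t p, t \in S -> p != side t -> F (low t, p) = F (high t, p) &
      forall t, t \notin S -> F (low t, mid) = F (low t, out t) /\
                              F (high t, mid) = F (high t, out t)].

Lemma circle_invariantP S (U : Type) (F : A -> U) :
  circle_invariant S F <-> (forall x y, circle_rel S x y -> F x = F y).
Proof.
have ends := letter_ends.
have sideP t p : (p != low (letter t)) && (p != high (letter t)) = (p == side t).
  by case: (position t p) => ->; case: (ends t) => -[-> ->];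
    rewrite /out /side; case: (odd t).
split=> [[F1 F2 F3 F4]|Fe].
  suff Fj x y : joined (smoothed S) x y -> F x = F y by move=> x y /orP[] /Fj.
  case: x y => [l p] [l' p'] /orP[|/existsP[t]].
    case/andP=> /eqP /= ->; case/orP=> [/andP[/eqP-> /eqP->] //|/existsP[t]].
    by case/and4P=> /eqP-> /eqP-> pl ph; have /eqP-> : p' == side t by rewrite -sideP pl.
  rewrite /smoothing /= ffunE; have [tS|tS] := boolP (t \in S) => /=.
    have nside : low (letter t) != side t /\ high (letter t) != side t.
      by rewrite ![_ == side t]eq_sym; case: (ends t) => -[-> ->]; rewrite side_mid side_out.
    rewrite !xpair_eqE; case/orP=> /andP[/andP[/eqP-> /eqP->] /andP[/eqP-> /eqP->]];
      by rewrite F3 //; case: nside.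
  have [F4l F4h] := F4 t tS.
  rewrite !xpair_eqE; case/orP=> /andP[/andP[/eqP-> /eqP->] /andP[/eqP-> /eqP->]];
    by case: (ends t) => -[-> ->].
split.
- by move=> p; apply: Fe; rewrite /circle_rel /= /joined /= /braid_glued /= !eqxx.
- move=> t; apply: Fe; apply/orP; left; apply/orP; left.
  rewrite /= /braid_glued /= eqxx /=; apply/orP; right; apply/existsP; exists t.
  by rewrite !eqxx /= sideP.
- move=> t p tS pside; apply: Fe.
  have : (p == low (letter t)) || (p == high (letter t)).
    by rewrite -[_ || _]negbK negb_or sideP.
  case/orP=> /eqP->; apply/orP; [right | left]; apply/orP; right; apply/existsP;
    exists t; by rewrite /smoothing /= ffunE tS /= !eqxx ?orbT.
move=> t tS.
have Fl : F (low t, high (letter t)) = F (low t, low (letter t)).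
  apply: Fe; apply/orP; left; apply/orP; right; apply/existsP; exists t.
  by rewrite /smoothing /= ffunE tS /= !eqxx.
have Fh : F (high t, high (letter t)) = F (high t, low (letter t)).
  apply: Fe; apply/orP; left; apply/orP; right; apply/existsP; exists t.
  by rewrite /smoothing /= ffunE tS /= !eqxx orbT.
by case: (ends t) Fl Fh => -[-> ->].
Qed.

(** Numbering the levels cyclically by the crossings above them makes the
    closing arcs disappear. *)
Definition level_invariant S (U : Type) (G : 'I_N -> 'I_3 -> U) : Prop :=
  [/\ forall t, G t (side t) = G (ordS t) (side t),
      forall t p, t \in S -> G t p = G (ordS t) p &
      forall t, t \notin S -> G t mid = G t (out t) /\
                              G (ordS t) mid = G (ordS t) (out t)].

Lemma high_lowS (U : Type) (F : A -> U) t p :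
  (forall p, F (ord_max, p) = F (ord0, p)) -> F (high t, p) = F (low (ordS t), p).
Proof.
move=> F1; have := ordS_nat t; case: eqP => [tN|_] tS.
  have -> : high t = ord_max by apply: ord_inj; rewrite /= /bump /=.
  by have -> : low (ordS t) = ord0 by apply: ord_inj.
congr (F (_, _)); apply: ord_inj.
by transitivity (ordS t : nat); first by rewrite tS.
Qed.

Lemma level_invariant_of S (U : Type) (F : A -> U) :
  circle_invariant S F -> level_invariant S (fun t p => F (low t, p)).
Proof.
move=> [F1 F2 F3 F4]; split=> [t|t p tS|t /F4].
- by rewrite F2 high_lowS.
- have [->|pside] := eqVneq p (side t); first by rewrite F2 high_lowS.
  by rewrite F3 // high_lowS.
by rewrite !high_lowS.
Qed.

Definition crossing0 : 'I_N := Ordinal (ltn_trans (isT : 0 < 3)%N N_gt3).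

Definition above (l : 'I_N.+1) : 'I_N := insubd crossing0 (l : nat).

Lemma above_low t : above (low t) = t.
Proof. by apply: ord_inj; rewrite val_insubd /= ltn_ord. Qed.

Lemma above_high t : above (high t) = ordS t.
Proof.
apply: ord_inj; rewrite val_insubd [RHS]ordS_nat /= /bump /= add1n.
by case: eqP => [->|tN]; [rewrite ltnn | case: ltnP => //; have := ltn_ord t; lia].
Qed.

Lemma above_ends : above ord_max = above ord0.
Proof. by apply: ord_inj; rewrite !val_insubd /= ltnn; case: ltnP. Qed.

Lemma circle_invariant_of S (U : Type) (G : 'I_N -> 'I_3 -> U) :
  level_invariant S G -> circle_invariant S (fun x => G (above x.1) x.2).
Proof.
move=> [G2 G3 G4]; split=> [p|t|t p tS _|t tS] /=.
- by rewrite above_ends.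
- by rewrite above_low above_high.
- by rewrite above_low above_high G3.
by rewrite above_low above_high; apply: G4.
Qed.

Lemma arc_level (U : Type) (F : A -> U) x :
  (forall p, F (ord_max, p) = F (ord0, p)) -> exists t, F x = F (low t, x.2).
Proof.
case: x => l p F1 /=; have [lN|lN] := ltnP l N.
  by exists (Ordinal lN); congr (F (_, _)); apply: ord_inj.
exists crossing0; have -> : l = ord_max.
  by apply: ord_inj => /=; have := ltn_ord l; lia.
by rewrite F1; congr (F (_, _)); apply: ord_inj.
Qed.

Local Notation circle_root S := (fingraph.root (circle_rel S)).
Definition circle_count S : nat := #|roots (circle_rel S)|.
Local Notation level_root S := (fun t p => circle_root S (low t, p)).

Lemma circle_rootP S x y :
  (circle_root S x == circle_root S y) = same_circle (smoothed S) x y.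
Proof. exact: (root_connect (sym_connect_sym (circle_rel_sym S))). Qed.

Lemma circle_root_invariant S : circle_invariant S (circle_root S).
Proof.
apply/circle_invariantP => x y xy; apply/eqP; rewrite circle_rootP.
exact: connect1.
Qed.

Lemma out_ord_pred t : out (ord_pred t) = side t.
Proof. by rewrite -{2}(ord_predK t) side_ordS. Qed.

(** Two consecutive B-smoothings join [mid] to both other positions of the level
    between them. *)
Lemma level_full S t (G := level_root S) : t \notin S -> ord_pred t \notin S ->
  forall p, G t p = G t mid.
Proof.
have [_ _ G4] := level_invariant_of (circle_root_invariant S).
move=> /G4[Gt _] /G4[_]; rewrite ord_predK out_ord_pred => Gt' p.
by case: (position t p) => -> //.
Qed.

(** Consecutive levels are always joined along the strand beside the crossing. *)
Lemma circle_count_le1 S (G := level_root S) :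
  (forall t p, G t p = G t mid) -> (circle_count S <= 1)%N.
Proof.
have [G2 _ _] := level_invariant_of (circle_root_invariant S).
move=> full; apply: (@card_roots_le1 _ _ (low crossing0, mid)) => x.
have [F1 _ _ _] := circle_root_invariant S.
have [t ->] := arc_level x F1; rewrite -/(G t _) full /G.
have [m] := ubnP (t : nat); elim: m t => // m IHm t tm.
have [t0|t0] := posnP t; first by congr (fingraph.root _ (_, _)); apply: ord_inj.
have tE : t = ordS (ord_pred t) by rewrite ord_predK.
have lt_t : (ord_pred t < t)%N.
  have := ordS_nat (ord_pred t); rewrite -tE; case: eqP => _; lia.
rewrite -(IHm (ord_pred t)); last by lia.
have /esym E := G2 (ord_pred t); rewrite -tE in E.
by have := full t (side (ord_pred t)); have := full (ord_pred t) (side (ord_pred t));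
   rewrite /G -E => -> ->.
Qed.

Lemma circle_count0 : (circle_count set0 <= 1)%N.
Proof. by apply: circle_count_le1 => t p; apply: level_full; rewrite inE. Qed.

(** The levels around [c] and [ordS c] are identified by the two A-smoothings,
    and the B-smoothings before and after them join different pairs of
    positions. *)
Lemma circle_count_pair c : (circle_count [set c; ordS c] <= 1)%N.
Proof.
set S := [set c; ordS c].
have [G2 G3 G4] := level_invariant_of (circle_root_invariant S).
have cS : c \in S by rewrite !inE eqxx.
have c1S : ordS c \in S by rewrite !inE eqxx orbT.
set c1 := ordS c in c1S *; set c2 := ordS c1.
have c2S : c2 \notin S.
  rewrite !inE -!(inj_eq (@ord_inj _)) /c2 /c1 !ordS_nat.
  by have := ltn_ord c; case: (eqVneq c.+1 N) => cN; case: ifP; lia.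
have bS : ord_pred c \notin S.
  rewrite !inE; apply/norP; split; apply/eqP => E.
    have := ordS_nat (ord_pred c); rewrite ord_predK E.
    by case: eqP; lia.
  have := ordS_nat (ord_pred c); rewrite ord_predK E /c1 ordS_nat.
  by have := ltn_ord c; case: (eqVneq c.+1 N) => cN; case: ifP; lia.
have full_c p : level_root S c p = level_root S c mid.
  have [_] := G4 _ bS; rewrite ord_predK out_ord_pred => side_c.
  have [out_c _] := G4 _ c2S; rewrite /c2 /c1 !out_ordS side_ordS in out_c.
  case: (position c p) => -> //.
  rewrite (G3 c (out c)) // (G3 c1 (out c)) // -/c2 -out_c.
  by rewrite -(G3 c1 mid) // -(G3 c mid).
apply: circle_count_le1 => t p.
have [->|tc] := eqVneq t c; first exact: full_c.
have [->|tc1] := eqVneq t c1; first by rewrite -!(G3 c).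
have [->|tc2] := eqVneq t c2; first by rewrite -!(G3 c1) // -!(G3 c).
apply: level_full; rewrite !inE ?negb_or ?tc ?tc1 //.
by apply/andP; split; [apply: contraNneq tc1 | apply: contraNneq tc2] => E;
  rewrite /c2 -?E /c1 -?E ord_predK.
Qed.

(** Joining all four ends of [c] can only merge circles of [S].  The same
    classes of arcs arise from the circles of [c |: S] by identifying the two
    strands of the A-smoothing, which merges at most two of them. *)
Lemma circle_countU1 S c : (circle_count (c |: S) <= (circle_count S).+1)%N.
Proof.
have [F1 F2 F3 F4] := circle_root_invariant (c |: S).
apply: (card_roots_merge (a := (low c, mid)) (b := (low c, out c))).
- exact: circle_rel_sym.
- exact: circle_rel_sym.
apply/(circle_invariantP S (fun x => if circle_root _ x == _ then _ else _)).
have cS : c \in c |: S by rewrite setU11.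
split=> [p|t|t p tS pside|t tS].
- by rewrite F1.
- by rewrite F2.
- by rewrite F3 // inE tS orbT.
have [->|tc] := eqVneq t c.
  rewrite -!F3 //; last 2 first.
  - by rewrite eq_sym side_out.
  - by rewrite eq_sym side_mid.
  by rewrite eqxx; case: eqP.
have [Fl Fh] := F4 t ltac:(by rewrite !inE negb_or tc).
by rewrite Fl Fh.
Qed.

Lemma circle_count_subset S1 S2 : S1 \subset S2 ->
  (circle_count S2 + #|S1| <= circle_count S1 + #|S2|)%N.
Proof.
move=> S12; have [m] := ubnP #|S2 :\: S1|; elim: m S2 S12 => // m IHm S2 S12 S2m.
have [S21|] := boolP (S2 \subset S1).
  by have -> : S2 = S1 by apply/eqP; rewrite eqEsubset S21.
case/subsetPn=> c cS2 cS1.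
have S1c : S1 \subset S2 :\ c.
  by apply/subsetP => t tS1; rewrite !inE (subsetP S12) // andbT; apply: contraNneq cS1 => <-.
have := circle_countU1 (S2 :\ c) c; rewrite setD1K //.
have := IHm _ S1c; rewrite (cardsD1 c S2) cS2.
have -> : (S2 :\ c) :\: S1 = (S2 :\: S1) :\ c by rewrite !setDDl setUC.
have : c \in S2 :\: S1 by rewrite !inE cS1.
by move: S2m; rewrite (cardsD1 c (S2 :\: S1)) => + cin; rewrite cin; lia.
Qed.

Lemma circle_count_le S : (circle_count S <= #|S|.+1)%N.
Proof.
by have := circle_count_subset (sub0set S); have := circle_count0; rewrite cards0; lia.
Qed.

Local Notation independent S := (S \in independence_complex (@cycle_graph N)).

Lemma independentP S :
  reflect (forall t, t \in S -> ordS t \notin S) (independent S).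
Proof.
rewrite inE; apply: (iffP forall_inP) => [indep t tS|indep u uS].
  apply/negP => t1S; have /forall_inP/(_ _ t1S) := indep t tS.
  by rewrite /cycle_graph /= eqxx.
apply/forall_inP => v vS; rewrite /cycle_graph /= negb_or; apply/andP; split.
  by apply: contraL vS => /eqP ->; apply: indep.
by apply: contraL uS => /eqP ->; apply: indep.
Qed.

(** Two consecutive crossings of [S] cost two circles in the induction from
    [circle_count_pair], so the bound [#|S|.+1] is missed by two. *)
Lemma circle_count_dependent S : ~~ independent S -> (circle_count S <= #|S|)%N.
Proof.
move=> dep; have [c cS c1S] : exists2 c, c \in S & ordS c \in S.
  have [c /andP[cS c1S]|none] := pickP [pred c | (c \in S) && (ordS c \in S)].
    by exists c.
  case/independentP: dep => t tS; apply/negP => t1S.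
  by have /= := none t; rewrite tS t1S.
have : [set c; ordS c] \subset S by rewrite subUset !sub1set cS.
move/circle_count_subset; have := circle_count_pair c; rewrite cards2.
have -> : c != ordS c; last first.
  by move: (circle_count _) (circle_count S) #|S| => k1 k2 m; clear; lia.
apply/eqP => /(congr1 (@nat_of_ord N)); rewrite ordS_nat.
by have := ltn_ord c; case: ifP; lia.
Qed.

(** For an independent set, each A-labelled crossing [t] has a circle of its
    own, which runs through the positions [mid] and [side t] of the levels
    below and above it; all other arcs lie on one further circle. *)
Definition circle_index S t p : option 'I_N :=
  if (t \in S) && (p != out t) then Some t
  else if (ord_pred t \in S) && (p != side t) then Some (ord_pred t) else None.

Lemma circle_index_invariant S : independent S ->
  level_invariant S (circle_index S).
Proof.
move=> /independentP indep; rewrite /circle_index.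
have indep' t : t \in S -> ord_pred t \notin S.
  by apply: contraL => /indep; rewrite ord_predK.
split=> [t|t p tS|t tS]; rewrite ?ordSK ?out_ordS ?side_ordS.
- by rewrite eqxx !andbF side_out /= !andbT; case: ifP.
- by rewrite tS (negPf (indep _ tS)) (negPf (indep' _ tS)).
rewrite (negPf tS) /=.
rewrite ![mid == _]eq_sym ![out t == _]eq_sym ?side_mid ?out_mid ?side_out.
by [].
Qed.

Lemma circle_count_independent S : independent S -> circle_count S = #|S|.+1.
Proof.
move=> indep; apply/eqP; rewrite eqn_leq circle_count_le /=.
pose F (x : A) := circle_index S (above x.1) x.2.
have /circle_invariantP Finv := circle_invariant_of (circle_index_invariant indep).
have := @card_roots_ge _ _ _ F (None |: [set Some t | t in S]) (circle_rel_sym S) Finv.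
rewrite cardsU1 card_imset; last by move=> ? ? [].
have -> : None \notin [set Some t | t in S] by apply/imsetP => -[].
rewrite add1n; apply => u; rewrite !inE => /orP[/eqP->|/imsetP[t tS ->]]; last first.
  exists (low t, mid); rewrite /F above_low /circle_index tS.
  by rewrite eq_sym out_mid.
have [S0|/set0Pn[t tS]] := eqVneq S set0.
  by exists (low crossing0, mid); rewrite /F /circle_index S0 !inE.
exists (low t, out t); rewrite /F above_low /circle_index eqxx andbF.
suff /negPf -> : ord_pred t \notin S by [].
move/independentP: indep => indep.
by apply: contraL tS => /indep; rewrite ord_predK.
Qed.

(** At an A-smoothing of an independent set, one strand is on the private circle
    of the crossing and the other is not. *)
Lemma ends_distinct S t : independent S -> t \in S ->
  same_circle (smoothed S) (low t, high (letter t)) (high t, low (letter t)) = false.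
Proof.
move=> indep tS; rewrite -circle_rootP; apply/eqP.
set x := (low t, _); set y := (high t, _) => /eqP; rewrite circle_rootP.
have /circle_invariantP Finv := circle_invariant_of (circle_index_invariant indep).
have [_ G3 _] := circle_index_invariant indep.
move/(connect_invariant Finv); rewrite /= above_low above_high -G3 // /circle_index tS.
have predS : ord_pred t \notin S.
  move/independentP: indep => indep.
  by apply: contraL tS => /indep; rewrite ord_predK.
case: (letter_ends t) => -[-> ->]; rewrite eqxx [mid == _]eq_sym out_mid /=;
  by rewrite (negPf predS).
Qed.

(** Once the crossing is relabelled B, the levels around it are both between two
    B-smoothings. *)
Lemma ends_joined S t : independent S -> t \in S ->
  same_circle (smoothed (S :\ t)) (low t, high (letter t)) (high t, low (letter t)).
Proof.
move=> /independentP indep tS; set T := S :\ t.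
have [F1 _ _ _] := circle_root_invariant T.
have [G2 _ G4] := level_invariant_of (circle_root_invariant T).
have tT : t \notin T by rewrite !inE eqxx.
have t1T : ordS t \notin T by rewrite !inE negb_and indep ?orbT.
have t'T : ord_pred t \notin T.
  rewrite !inE negb_and; apply/orP; right.
  by apply: contraL tS => /indep; rewrite ord_predK.
have full1 : forall p, level_root T (ordS t) p = level_root T (ordS t) mid.
  by apply: level_full => //; rewrite ordSK.
have full0 := level_full tT t'T.
rewrite -circle_rootP (high_lowS t _ F1); apply/eqP.
by rewrite full0 full1 -(full0 (side t)) -(full1 (side t)) G2.
Qed.

End Circles.
(** * The extreme part of the Khovanov complex *)

Section InversionSign.
Variable n : nat.
Implicit Types (S : {set 'I_n}) (c : 'I_n).

(** The Khovanov sign counts the B-labels after the changed crossing, the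
    simplicial sign the A-labels before it.  Removing [c] from [S] changes the
    number of pairs [a < b] with [a] in [S] and [b] outside by exactly the
    difference of these two counts, whence the change of basis below. *)
Definition inversions S : nat :=
  \sum_(a in S) #|[set b : 'I_n | (a < b)%N && (b \notin S)]|.

Definition inversion_sign S : int := (-1) ^+ inversions S.

Lemma inversion_sign2 S : inversion_sign S * inversion_sign S = 1.
Proof. by rewrite -expr2 sqrr_sign. Qed.

Lemma inversions_del S c : c \in S ->
  (inversions (S :\ c) + #|[set b : 'I_n | (c < b)%N && (b \notin S)]| =
   inversions S + #|[set u in S | (u < c)%N]|)%N.
Proof.
move=> cS; rewrite [in RHS]/inversions (big_setD1 c) //= addnC -addnA.
congr (_ + _)%N.
have -> : (#|[set u in S | u < c]| = \sum_(a in S :\ c) (a < c))%N.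
  rewrite -sum1_card big_mkcond [RHS]big_mkcond; apply: eq_bigr => u _.
  by rewrite !inE; case: eqVneq => [->|_]; rewrite ?ltnn ?andbF //;
    case: (u \in S); case: ltnP.
rewrite -big_split; apply: eq_bigr => a; rewrite !inE => /andP[ac aS].
rewrite (cardsD1 c) !inE eqxx /= andbT addnC; congr (#|pred_of_set _| + _)%N.
apply/setP => b; rewrite !inE negb_and negbK.
by case: eqVneq => //= ->; rewrite cS andbF.
Qed.

Lemma inversion_sign_del S c : c \in S ->
  (-1) ^+ #|[set b : 'I_n | (c < b)%N && (b \notin S)]| =
  inversion_sign S * inversion_sign (S :\ c) * vsign c S.
Proof.
move=> /inversions_del/(congr1 (fun m => (-1) ^+ m : int)); rewrite !exprD => E.
rewrite [_ S * _]mulrC -mulrA /vsign -[inversion_sign S * _]E.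
by rewrite mulrA inversion_sign2 mul1r.
Qed.

End InversionSign.

Section ExtremeComplex.
Variable w : seq 'I_2.
Local Notation N := (size w).
Hypothesis letterE : forall t : 'I_N, (letter t : nat) = ~~ odd t.
Hypothesis N_even : ~~ odd N.
Hypothesis N_gt3 : (3 < N)%N.
Local Notation D := (braid_closure w).
Implicit Types (S T : {set 'I_N}) (s t : enhanced_state D).

Definition A_set s : {set 'I_N} := [set c | labels s c == Alab].

Lemma labels_smoothed s : labels s = smoothed (A_set s).
Proof.
by apply/ffunP => c; rewrite ffunE inE; case: (labels s c).
Qed.

Lemma A_label S c : (smoothed S c == Alab) = (c \in S).
Proof. by rewrite ffunE; case: (c \in S). Qed.

Lemma B_label S c : (smoothed S c == Blab) = (c \notin S).
Proof. by rewrite ffunE; case: (c \in S). Qed.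

Lemma writheE : writhe D = N%:Z.
Proof. by rewrite /writhe /= sumr_const card_ord -mulr_natr mul1r natz. Qed.

Lemma sigmaE s : sigma s = 2 * #|A_set s|%:Z - N%:Z.
Proof.
have -> : N%:Z = \sum_(c < N) 1 by rewrite sumr_const card_ord -mulr_natr mul1r natz.
have -> : #|A_set s|%:Z = \sum_(c < N) (labels s c == Alab)%:R.
  rewrite -sum1_card big_mkcond /= -natz natr_sum; apply: eq_bigr => c _.
  by rewrite inE; case: eqP.
rewrite mulr_sumr -sumrB; apply: eq_bigr => c _.
by case: (labels s c).
Qed.

Lemma i_degreeE s : i_degree s = N%:Z - #|A_set s|%:Z.
Proof.
rewrite /i_degree writheE sigmaE.
have -> : N%:Z - (2 * #|A_set s|%:Z - N%:Z) = (N%:Z - #|A_set s|%:Z) * 2 by ring.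
by rewrite mulzK.
Qed.

(** All signs plus would give the number of circles; each minus costs 2. *)
Lemma tauE s : tau s = (circle_count (A_set s))%:Z -
  2 * #|[set x : braid_arc w | circle_roots (labels s) x && ~~ sign s x]|%:Z.
Proof.
have -> : (circle_count (A_set s))%:Z = \sum_(x | circle_roots (labels s) x) 1.
  rewrite sumr_const -mulr_natr mul1r natz /circle_count labels_smoothed.
  by congr Posz; apply: eq_card.
have -> : #|[set x : braid_arc w | circle_roots (labels s) x && ~~ sign s x]|%:Z =
    \sum_(x | circle_roots (labels s) x) (~~ sign s x)%:R.
  rewrite -sum1_card -natz natr_sum [RHS]big_mkcond [LHS]big_mkcond /=.
  apply: eq_bigr => x _; rewrite inE.
  by case: (circle_roots _ _) => //=; case: (sign s x).
rewrite mulr_sumr -sumrB; apply: eq_bigr => x _.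
by case: (sign s x).
Qed.

Lemma j_degree_le s : j_degree s <= 2 * N%:Z + 1.
Proof.
rewrite /j_degree writheE i_degreeE tauE.
by have := circle_count_le letterE N_even N_gt3 (A_set s); lia.
Qed.

Local Notation K := (independence_complex (@cycle_graph N)).
Local Notation jtop := (2 * N%:Z + 1).

Fact all_plus_enhanced S :
  is_enhanced (smoothed S : state D, [ffun _ : braid_arc w => true]).
Proof. by apply/forallP => x; apply/forallP => y; rewrite !ffunE eqxx implybT. Qed.

Definition all_plus S : enhanced_state D :=
  exist _ (smoothed S : state D, [ffun _ : braid_arc w => true]) (all_plus_enhanced S).

Lemma labels_all_plus S : labels (all_plus S) = smoothed S.
Proof. by []. Qed.

Lemma sign_all_plus S x : sign (all_plus S) x = true.
Proof. by rewrite /sign ffunE. Qed.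

Lemma A_set_all_plus S : A_set (all_plus S) = S.
Proof. by apply/setP => c; rewrite inE A_label. Qed.

Lemma sign_root s x :
  sign s x = sign s (fingraph.root (circle_rel (A_set s)) x).
Proof.
have /forallP/(_ x)/forallP/(_ (fingraph.root (circle_rel (A_set s)) x)) := valP s.
rewrite -/(labels s) labels_smoothed => /implyP sx; apply/eqP/sx.
exact: connect_root.
Qed.

(** As [j = 2 N - #|S| + tau] and [tau <= circle_count S <= #|S| + 1], the value
    [2 N + 1] forces equality twice. *)
Lemma j_degree_top s :
  (j_degree s == jtop) = (A_set s \in K) && (s == all_plus (A_set s)).
Proof.
have [indep|dep] := boolP (A_set s \in K); last first.
  rewrite /j_degree writheE i_degreeE tauE; apply/negbTE/eqP.
  by have := circle_count_dependent letterE N_even N_gt3 dep; lia.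
rewrite /= /j_degree writheE i_degreeE tauE.
rewrite (circle_count_independent letterE N_even N_gt3 indep).
set Z := [set x | _ & _]; transitivity (#|Z| == 0)%N; first by apply/eqP/eqP; lia.
rewrite cards_eq0; apply/eqP/eqP => [Z0|sE]; last first.
  apply/setP => x; rewrite !inE; have -> : sign s x by rewrite sE sign_all_plus.
  by rewrite andbF.
apply: val_inj; rewrite [RHS]/= -labels_smoothed [LHS]surjective_pairing.
congr pair; apply/ffunP => x; rewrite ffunE -[LHS]/(sign s x) sign_root.
move/setP/(_ (fingraph.root (circle_rel (A_set s)) x)): Z0.
have rootP := roots_root (sym_connect_sym (@circle_rel_sym w (A_set s))) x.
rewrite !inE; have -> : circle_roots (labels s) (fingraph.root (circle_rel (A_set s)) x).
  by rewrite labels_smoothed.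
by move/negbT; rewrite negbK.
Qed.

Lemma extreme_matched i d : d = N%:Z - 1 - i ->
  matched A_set all_plus (@in_bidegree D i jtop) (simplex_of_dim K d).
Proof.
move=> ->; split=> [s|S].
  rewrite /in_bidegree /= => /andP[/eqP <-]; rewrite j_degree_top => /andP[indep /eqP sE].
  by split; last exact: esym; rewrite /simplex_of_dim /= indep i_degreeE; apply/eqP; ring.
rewrite /simplex_of_dim /= => /andP[indep /eqP cardS].
split; last exact: A_set_all_plus.
rewrite /in_bidegree /= j_degree_top i_degreeE A_set_all_plus indep eqxx !andbT.
by apply/eqP; move: cardS; move: #|S| => m; lia.
Qed.

(** Relabelling a crossing of an independent set from A to B merges its two
    circles, and two plus signs merge into a plus. *)
Lemma adjacent_all_plus S T c : S \in K -> T \in K ->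
  adjacent_at c (all_plus S) (all_plus T) = (c \in S) && (T == S :\ c).
Proof.
move=> SK TK; rewrite /adjacent_at !labels_all_plus A_label B_label !sign_all_plus.
have -> : [forall x, ~~ same_circle (smoothed S) (end0 (cross c)) x ==>
    (~~ same_circle (smoothed S) (end2 (cross c)) x ==>
     (sign (all_plus T) x == sign (all_plus S) x))].
  by apply/forallP => x; rewrite !sign_all_plus eqxx !implybT.
have [cS|//] := boolP (c \in S).
set same_labels := [forall c', (c' != c) ==> _].
have labE : (c \notin T) && same_labels = (T == S :\ c).
  apply/andP/eqP => [[cT /forallP same]|TE]; last first.
    rewrite /same_labels TE; split; first by rewrite setD11.
    by apply/forallP => c'; apply/implyP => cc; rewrite !ffunE in_setD1 cc.
  apply/setP => c'; rewrite !inE; case: eqVneq => [->|cc] /=; first exact: negbTE.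
  by have := same c'; rewrite cc /= -A_label => /eqP->; rewrite A_label.
rewrite !andTb andbA labE; case: eqVneq => //= ->.
by rewrite (ends_distinct letterE N_even N_gt3) // (ends_joined letterE N_even).
Qed.

Lemma extreme_compatible i i' :
  compatible (@incidence D) (@face_sign N) A_set (@inversion_sign N)
    (@in_bidegree D i jtop) (@in_bidegree D i' jtop).
Proof.
move=> s t /andP[_ +] /andP[_]; rewrite !j_degree_top.
move=> /andP[sK /eqP sE] /andP[tK /eqP tE].
rewrite /incidence /face_sign mulr_sumr.
have adjE c : adjacent_at c s t = (c \in A_set s) && (A_set t == A_set s :\ c).
  by rewrite sE tE adjacent_all_plus // !A_set_all_plus.
apply: eq_big => // c; rewrite adjE => /andP[cs /eqP->].
rewrite -/(vsign c _) -inversion_sign_del //; congr (_ ^+ #|pred_of_set _|).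
by apply/setP => b; rewrite !inE; case: (labels s b).
Qed.

Theorem khovanov_extreme i : zmod_iso (khovanov D i jtop)
  (reduced_homology K (N%:Z - 1 - i)).
Proof.
apply: (chain_homology_relabel (f := A_set) (g := all_plus) (eps := @inversion_sign N)).
- exact: inversion_sign2.
- by apply: extreme_matched; ring.
- exact: extreme_matched.
- by apply: extreme_matched; ring.
- exact: extreme_compatible.
exact: extreme_compatible.
Qed.

Lemma khovanov_above i j : jtop < j -> trivial_zmod (khovanov D i j).
Proof.
move=> jj; apply: homology_trivial => c _; exists 0; rewrite raddf0.
apply: eq_coef => s; rewrite /coef; case: insubP => // u /andP[_ /eqP su] _.
by have := j_degree_le s; rewrite su leNgt jj.
Qed.

End ExtremeComplex.

(** * Torus links on three strands *)

Lemma torus_word_size q : size (flatten (nseq q (rev (enum 'I_2)))) = (2 * q)%N.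
Proof.
by elim: q => //= q IHq; rewrite size_cat IHq size_rev size_enum_ord; lia.
Qed.

Lemma torus_letter q (w := flatten (nseq q (rev (enum 'I_2)))) (t : 'I_(size w)) :
  (letter t : nat) = ~~ odd t.
Proof.
(* The word alternates: its first letter is the larger one. *)
have wE : rev (enum 'I_2) = [:: ord_max; ord0].
  by apply: (inj_map val_inj); rewrite map_rev val_enum_ord.
rewrite /letter (tnth_nth ord0) /=; have := ltn_ord t; move: (t : nat).
rewrite /w wE {t w}; elim: q => [|q IHq] [|[|i]] //= iq.
by rewrite negbK IHq.
Qed.

Lemma khovanov_torus3 q i : (1 < q)%N ->
  zmod_iso (khovanov (torus_link 3 q) i (4 * q%:Z + 1))
    (reduced_homology (independence_complex (@cycle_graph (2 * q)))
       (2 * q%:Z - 1 - i)).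
Proof.
move=> q_gt1; have size_w := torus_word_size q.
have := khovanov_extreme (@torus_letter q) _ _ i.
rewrite !size_w mul2n odd_double -mul2n => /(_ isT)/(_ ltac:(lia)).
have -> : 2 * (2 * q)%N%:Z + 1 = 4 * q%:Z + 1 by lia.
by have -> : (2 * q)%N%:Z - 1 - i = 2 * q%:Z - 1 - i by lia.
Qed.

Lemma khovanov_torus3_above q i j : (1 < q)%N -> 4 * q%:Z + 1 < j ->
  trivial_zmod (khovanov (torus_link 3 q) i j).
Proof.
move=> q_gt1 jq; have size_w := torus_word_size q.
apply: (khovanov_above (@torus_letter q)); rewrite ?size_w; lia.
Qed.

(* For q = 1 the link is the unknot, whose only non-trivial groups are
   H^{0,1} = H^{0,-1} = Z, and the asserted isomorphism fails: its right-hand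
   side is Z for i = 1. Hence the hypothesis 1 < q. *)
Theorem corollary7p7 (q : nat) (hq : (1 < q)%N) :
  exists jb : int, is_real_jmax (torus_link 3 q) jb /\
  forall i : int,
    zmod_iso (khovanov (torus_link 3 q) i jb)
      (reduced_homology (independence_complex (@cycle_graph (2 * q)))
         (2 * q%:Z - 1 - i)) /\
    forall k : int,
      (((2 * q%:Z = 3 * k + 1 \/ 2 * q%:Z = 3 * k - 1) /\ i = 2 * q%:Z - k ->
         zmod_iso (khovanov (torus_link 3 q) i jb) int) /\
       (2 * q%:Z = 3 * k /\ i = 2 * q%:Z - k ->
         zmod_iso (khovanov (torus_link 3 q) i jb) (int * int)%type) /\
       ((2 * q%:Z = 3 * k \/ 2 * q%:Z = 3 * k + 1 \/ 2 * q%:Z = 3 * k - 1) /\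
          i <> 2 * q%:Z - k ->
         trivial_zmod (khovanov (torus_link 3 q) i jb))).
Proof.
have n_gt3 : (3 < 2 * q)%N by lia.
have nE : (2 * q)%N%:Z = 2 * q%:Z by lia.
have iso i := khovanov_torus3 i hq.
have groups i k := reduced_homology_cycle (2 * q%:Z - 1 - i) k n_gt3.
rewrite nE in groups.
exists (4 * q%:Z + 1); split; last first.
  move=> i; split=> // k; have [rank1 rank2 rank0] := groups i k.
  split; [|split] => -[nk ik].
  - by apply: zmod_iso_trans (iso i) (rank1 nk _); lia.
  - by apply: zmod_iso_trans (iso i) (rank2 nk _); lia.
  by apply: zmod_iso_trivial (iso i) (rank0 nk _); lia.
split=> [|i j nontriv]; last first.
  by rewrite leNgt; apply/negP => /(@khovanov_torus3_above q i j hq)/nontriv.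
(* The integer with [2q] equal to [3k] or [3k + 1] or [3k - 1]. *)
pose k : int := ((2 * q).+1 %/ 3)%N%:Z; exists (2 * q%:Z - k) => triv.
have {triv}triv := zmod_iso_trivial (zmod_iso_sym (iso _)) triv.
have [rank1 rank2 _] := groups (2 * q%:Z - k) k.
have int_nontriv : ~ trivial_zmod int by move/(_ 1).
have dk : 2 * q%:Z - 1 - (2 * q%:Z - k) = k - 1 by ring.
have [n0|n0] := eqVneq ((2 * q) %% 3)%N 0%N; apply: int_nontriv.
  have nk : 2 * q%:Z = 3 * k by rewrite /k; lia.
  move=> x; have := zmod_iso_trivial (zmod_iso_sym (rank2 nk dk)) triv (x, x).
  by move/(congr1 fst).
have nk : 2 * q%:Z = 3 * k + 1 \/ 2 * q%:Z = 3 * k - 1 by rewrite /k; lia.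
exact: zmod_iso_trivial (zmod_iso_sym (rank1 nk dk)) triv.
Qed.
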